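(* The subvariety lattice of the variety $\mathcal{V}_{ac}$ is \[ \mathbf{T}<\mathsf{V}(S_{\mathbf{p}_1})<\mathsf{V}(S_{\mathbf{p}_1}\circ S_{\mathbf{p}_1})<\cdots <\mathsf{V}(S_{\mathbf{p}_n})<\mathsf{V}(S_{\mathbf{p}_n}\circ S_{\mathbf{p}_n})<\cdots<\mathcal{V}_{ac}, \] which is isomorphic to $\boldsymbol{\omega}\oplus \mathbf{1}$, the linear sum of the chain $\boldsymbol\omega$ of natural numbers under the usual order and the trivial one-element lattice $\mathbf{1}$, where $\mathbf{1}$ corresponds to $\mathcal{V}_{ac}$.
   Context: An additively idempotent semiring (ai-semiring) is an algebra $(S,+,\cdot)$ with two binary operations such that $(S,+)$ is a commutative idempotent semigroup, $(S,\cdot)$ is a semigroup, and both distributive laws $(x+y)z=xz+yz$, $x(y+z)=xy+xz$ hold. A flat semiring is an ai-semiring $S$ whose multiplicative reduct has a zero element $0$ and in which $a+b=0$ for all distinct $a,b\in S$. It is $3$-nilpotent if $a_1a_2a_3=0$ for all $a_1,a_2,a_3\in S$. $\mathbf{NF}_3$ is the variety (in the signature $(+,\cdot)$) generated by all $3$-nilpotent flat semirings. Graphs are directed (loops allowed, possibly empty, possibly infinite), contain no isolated vertices, and every vertex has out-degree at most $1$ and in-degree at most $1$. For such a graph $\mathbb G$, the graph semiring $S_{\mathbb G}$ is the flat semiring on the disjoint union of $V(\mathbb G)$ and $\{0,\omega\}$, with $x\cdot y=\omega$ if $x,y\in V(\mathbb G)$ and $(x,y)\in E(\mathbb G)$,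 $x\cdot y=0$ otherwise, and $x+x=x$, $x+y=0$ for $x\ne y$. The graph semiring $S_{\mathbb G}$ is acyclic if $\mathbb G$ contains no (directed) cycles, loops being cycles of length $1$. $\mathcal{V}_{ac}$ is the subvariety of $\mathbf{NF}_3$ generated by all acyclic graph semirings. For $m\ge 2$, $S_{\mathbf{p}_m}$ is the graph semiring of the path graph with vertices $a_1,\dots,a_m$ and edges $(a_i,a_{i+1})$, $1\le i<m$. For $m=1$ the same construction is applied to the graph with the single vertex $a_1$ and no edges (although this vertex is isolated), so $S_{\mathbf{p}_1}=\{0,\omega,a_1\}$ is the flat semiring in which all products are $0$. For $n\ge 1$, $S_{\mathbf{p}_n}\circ S_{\mathbf{p}_n}$ denotes two copies of $S_{\mathbf{p}_n}$ glued along $\{0,\omega\}$, with all products between distinct copies equal to $0$ and sums of distinct elements equal to $0$. In the displayed chain $n$ runs through the integers $n\ge 1$. $\mathsf V(S)$ is the variety generated by $S$, $\mathbf T$ is the trivial variety, and $<$ means ''is a proper subvariety of''.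
   Formalization: The first link V(S_p1) < V(S_p1∘S_p1) is false: all products vanish and S_p1∘S_p1 embeds in S_p1×S_p1, so the two varieties are equal. The formal theorem states this equality, and V(S_pn) < V(S_pn∘S_pn) only for n ≥ 2; the rest of the chain is unchanged. *)

(* Defs.v *)
From mathcomp Require Import all_boot.
From mathcomp Require Import boolp.
Set Implicit Arguments.
Unset Strict Implicit.
Unset Printing Implicit Defensive.

Record algebra := Algebra {
  carrier :> Type;
  sadd : carrier -> carrier -> carrier;
  smul : carrier -> carrier -> carrier;
  carrier_inhabited : inhabited carrier }.

Definition is_hom (A B : algebra) (f : A -> B) : Prop :=
  {morph f : x y / sadd x y} /\ {morph f : x y / smul x y}.

Lemma product_inhabited (I : Type) (A : I -> algebra) :
  inhabited (forall i, A i).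
Proof.
have ne i : exists x : A i, True by case: (carrier_inhabited (A i)) => x; exists x.
by constructor=> i; case: (cid (ne i)).
Qed.

Definition product (I : Type) (A : I -> algebra) : algebra :=
  @Algebra (forall i, A i) (fun x y i => sadd (x i) (y i))
    (fun x y i => smul (x i) (y i)) (product_inhabited A).

(* Classes of algebras are plain predicates: the universe of [classical_sets.set]
   would have to lie above that of the carriers, which then could not be library
   types such as 'I_m. *)
Definition class := algebra -> Prop.

Definition subclass (K L : class) : Prop := forall A, K A -> L A.

(* Subalgebras are taken up to isomorphism.  The empty index type is allowed
   in products, so every variety contains the one-element algebras. *)
Definition variety (K : class) : Prop :=
  [/\ forall (A B : algebra) (f : B -> A),
        K A -> is_hom f -> injective f -> K B,
      forall (A B : algebra) (f : A -> B),
        K A -> is_hom f -> (forall b, exists a, f a = b) -> K B &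
      forall (I : Type) (A : I -> algebra),
        (forall i, K (A i)) -> K (product A)].

Definition generated_variety (K : class) : class :=
  fun A => forall W, variety W -> subclass K W -> W A.

Definition subvariety (W U : class) : Prop :=
  [/\ variety W, variety U & subclass W U].

Definition proper_subvariety (W U : class) : Prop :=
  subvariety W U /\ W <> U.

Definition generated_subvariety (U K : class) : class :=
  fun A => forall W, subvariety W U -> subclass K W -> W A.

Definition trivial_variety : class :=
  fun A => forall x y : A, x = y.

Definition ai_semiring (A : algebra) : Prop :=
  [/\ associative (@sadd A), commutative (@sadd A), idempotent_op (@sadd A),
      associative (@smul A) &
      left_distributive (@smul A) (@sadd A) /\
      right_distributive (@smul A) (@sadd A)].

Definition is_zero (A : algebra) (z : A) : Prop :=
  left_zero z (@smul A) /\ right_zero z (@smul A).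

Definition flat_semiring (A : algebra) : Prop :=
  ai_semiring A /\
  exists2 z : A, is_zero z & forall a b : A, a <> b -> sadd a b = z.

Definition nilpotent3 (A : algebra) : Prop :=
  exists2 z : A, is_zero z & forall a b c : A, smul (smul a b) c = z.

Definition NF3 : class :=
  generated_variety (fun A => flat_semiring A /\ nilpotent3 A).

Record digraph := Digraph { vertex :> Type; edge : vertex -> vertex -> Prop }.

Definition admissible (G : digraph) : Prop :=
  [/\ forall x : G, exists y, edge x y \/ edge y x,
      forall x y z : G, edge x y -> edge x z -> y = z &
      forall x y z : G, edge y x -> edge z x -> y = z].

(* A directed cycle of length n.+1; [ordS] is the cyclic successor. *)
Definition is_cycle (G : digraph) n (c : 'I_n.+1 -> G) : Prop :=
  injective c /\ forall i, edge (c i) (c (ordS i)).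

Definition acyclic (G : digraph) : Prop :=
  forall n (c : 'I_n.+1 -> G), ~ is_cycle c.

Inductive flat_elt (V : Type) := Zero | Omega | Vert of V.
Arguments Zero {V}.
Arguments Omega {V}.

Definition flat_add (V : Type) (x y : flat_elt V) : flat_elt V :=
  if `[< x = y >] then x else Zero.

Definition graph_mul (G : digraph) (x y : flat_elt G) : flat_elt G :=
  match x, y with
  | Vert a, Vert b => if `[< edge a b >] then Omega else Zero
  | _, _ => Zero
  end.

Definition graph_semiring (G : digraph) : algebra :=
  Algebra (@flat_add G) (@graph_mul G) (inhabits Zero).

Definition Vac : class :=
  generated_subvariety NF3
    (fun A => exists G, [/\ admissible G, acyclic G & A = graph_semiring G]).

Definition map_vert (V W : Type) (f : V -> W) (x : flat_elt V) : flat_elt W :=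
  match x with Zero => Zero | Omega => Omega | Vert a => Vert (f a) end.

Definition glue_mul (G H : digraph) (x y : flat_elt (G + H)) :
    flat_elt (G + H) :=
  match x, y with
  | Vert (inl a), Vert (inl b) => map_vert inl (graph_mul (Vert a) (Vert b))
  | Vert (inr a), Vert (inr b) => map_vert inr (graph_mul (Vert a) (Vert b))
  | _, _ => Zero
  end.

(* S_G and S_H glued along {0, omega}. *)
Definition glued_semiring (G H : digraph) : algebra :=
  Algebra (@flat_add (G + H)) (@glue_mul G H) (inhabits Zero).

Definition path_graph (m : nat) : digraph :=
  @Digraph 'I_m (fun i j => j = i.+1 :> nat).

Definition Vp (n : nat) : class :=
  generated_variety (eq (graph_semiring (path_graph n))).

(* At n = 1 all products vanish and S_p1 o S_p1 embeds into S_p1 x S_p1 by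
   omega |-> (omega, omega), a |-> (a1, 0), b |-> (0, a1), so that
   [Vpp 1 = Vp 1]; the inclusion [Vp n] < [Vpp n] is proper only for n >= 2. *)
Definition Vpp (n : nat) : class :=
  generated_variety (eq (glued_semiring (path_graph n) (path_graph n))).

Definition subvarieties (U : class) := {W | subvariety W U}.

Definition linear_sum (P Q : Type) (leP : P -> P -> Prop)
    (leQ : Q -> Q -> Prop) (x y : P + Q) : Prop :=
  match x, y with
  | inl p, inl p' => leP p p'
  | inr q, inr q' => leQ q q'
  | inl _, inr _ => True
  | inr _, inl _ => False
  end.

Definition omega_plus_one : nat + unit -> nat + unit -> Prop :=
  linear_sum (fun m n => (m <= n)%N) (fun _ _ => True).

(* Main.v *)
Require Import Defs.
From mathcomp Require Import all_boot.
From mathcomp Require Import boolp zify.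
Set Implicit Arguments.
Unset Strict Implicit.
Unset Printing Implicit Defensive.

(** The proof has an upper half, which describes all the subvarieties, and a
    lower half, which separates those that occur.

    Every variety W below NF_3 is generated by the graph semirings it contains.
    Let A be in W and let b in A be different from the top element 0 of the
    order (x <= y iff x + y = y).  Identify two elements when the same
    translations (the identity, u * _ and _ * u) send them below b.  The laws of
    flat 3-nilpotent semirings force the quotient to be a graph semiring: the
    class below b is omega, the elements that no translation sends below b form
    the class 0, the other classes are vertices, and x -> y is an edge when
    x y <= b ([syntactic_quotient]).  These quotients separate the points of A
    ([variety_graph_generated]).  For W below V_ac the graphs so obtained are
    acyclic, because for each n the sum of x_i x_(i+1) over a cycle of length n
    is identically 0 in V_ac ([Vac_acyclic]).

    Membership of a graph semiring in a variety is shown by maps of graphs: if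
    the maps G -> H_i preserve edges and jointly reflect equality and edges, and
    all S_(H_i) are in V, then S_G is in V ([graph_semiring_maps]).  The images
    of S_G in the product satisfy the relations of S_G once all tuples with a
    coordinate 0 are collapsed.  A graph whose walks have at most n edges is a
    disjoint union of directed paths with at most n + 1 vertices.  Each of these
    can be moved, independently of the others, to either copy of the path
    with n + 1 vertices, so S_G is in V(S_p o S_p) for p = p_(n+1)
    ([bounded_graph_semiring_of_double_path]).  If at most one component has
    n + 1 vertices, a single copy suffices: the shorter components can be
    shifted by one ([bounded_graph_semiring_of_path]).  Finally any acyclic
    graph is the limit of the graphs obtained by keeping the edges that start in
    a finite set, and these have bounded walks ([paths_generate_Vac]).

    Hence a nontrivial W below V_ac is all of V_ac if its graphs have walks of
    unbounded length; otherwise, with n + 1 the largest number of vertices of a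
    path in one of its graphs, W is V(S_p o S_p) or V(S_p), according to
    whether such a path occurs twice in one of its graphs; if all its graphs
    are empty, W is V(S_(p_1)) ([subvarieties_of_Vac]).

    Strictness comes from two laws.  The sum of n + 1 consecutive products
    x_0 x_1 + ... + x_n x_(n+1) is 0 in S_G exactly when G has no walk with
    n + 1 edges ([no_walk_law]).  In a single path with n + 2 vertices two
    such nonzero sums are supported on the same walk, so the product of
    x_0 with the second vertex of the other walk may be added; in two disjoint
    copies it may not ([merge_law]). *)

(** * Varieties *)

Lemma class_ext (K L : class) : subclass K L -> subclass L K -> K = L.
Proof.
by move=> KL LK; apply/funext => A; apply/propext; split; [apply: KL | apply: LK].
Qed.

Lemma generated_variety_variety K : variety (generated_variety K).
Proof.
split.
- by move=> A B f KA fh fi W vW KW; case: (vW) => S _ _; apply: S fh fi; apply: KA.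
- by move=> A B f KA fh fs W vW KW; case: (vW) => _ H _; apply: H fh fs; apply: KA.
- move=> I A KA W vW KW; case: (vW) => _ _ P; apply: P => i; exact: KA.
Qed.

Lemma generated_variety_gen K : subclass K (generated_variety K).
Proof. by move=> A KA W _; apply. Qed.

Lemma generated_variety_min K V :
  variety V -> subclass K V -> subclass (generated_variety K) V.
Proof. by move=> vV KV A; apply. Qed.

(** A one-element algebra is a quotient of the empty product. *)
Lemma variety_trivial V : variety V -> subclass trivial_variety V.
Proof.
move=> [_ H P] A tA; case: (carrier_inhabited A) => a.
pose E (i : void) : algebra := A.
apply: (H (product E) A (fun _ => a)).
- by apply: P; case.
- by split=> x y; apply: tA.
- by move=> b; exists (fun i => a); apply: tA.
Qed.

Lemma trivial_variety_variety : variety trivial_variety.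
Proof.
split.
- by move=> A B f tA _ fi x y; apply: fi; apply: tA.
- move=> A B f tA _ fs x y; have [a <-] := fs x; have [b <-] := fs y.
  by rewrite (tA a b).
- by move=> I A tA x y; apply: functional_extensionality_dep => i; apply: tA.
Qed.

Lemma variety_subdirect (V : class) (A : algebra) (I : Type) (B : I -> algebra)
    (f : forall i, A -> B i) :
  variety V -> (forall i, V (B i)) -> (forall i, is_hom (f i)) ->
  (forall x y, (forall i, f i x = f i y) -> x = y) -> V A.
Proof.
move=> [S _ P] VB fh sep; apply: (S (product B) A (fun x i => f i x)).
- exact: P.
- by split=> x y; apply: functional_extensionality_dep => i; case: (fh i) => fD fM;
    rewrite /= ?fD ?fM.
- by move=> x y xy; apply: sep => i; apply: (f_equal (fun g => g i) xy).
Qed.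

(** Membership in HSP in the form used below: the domain of [R] is a subalgebra
    of the product and [R] is the graph of a homomorphism from it onto [A], so no
    quotient algebra has to be built. *)
Lemma variety_of_relation (V : class) (A : algebra) (I : Type)
    (B : I -> algebra) (R : product B -> A -> Prop) :
  variety V -> (forall i, V (B i)) ->
  (forall p q a b, R p a -> R q b -> R (sadd p q) (sadd a b)) ->
  (forall p q a b, R p a -> R q b -> R (smul p q) (smul a b)) ->
  (forall p a b, R p a -> R p b -> a = b) ->
  (forall a, exists p, R p a) -> V A.
Proof.
move=> [S H P] VB RD RM Rfun Rtot.
pose dom := {p : product B | exists a, R p a}.
have dD (p q : dom) : exists a, R (sadd (sval p) (sval q)) a.
  by case: p q => p [a pa] [q [b qb]]; exists (sadd a b); apply: RD.
have dM (p q : dom) : exists a, R (smul (sval p) (sval q)) a.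
  by case: p q => p [a pa] [q [b qb]]; exists (smul a b); apply: RM.
have ne : inhabited dom.
  case: (carrier_inhabited A) => a; have [p pa] := Rtot a.
  by constructor; exists p, a.
pose C := Algebra (fun p q : dom => exist _ _ (dD p q))
                  (fun p q : dom => exist _ _ (dM p q)) ne.
pose f (p : C) : A := sval (cid (svalP p)).
have fP (p : C) : R (sval p) (f p) by rewrite /f; case: cid.
apply: (H C A f).
- apply: (S (product B) C (fun p => sval p)); first exact: P.
  + by split.
  + by move=> [p ?] [q ?] /= pq; apply: eq_exist.
- split=> p q.
  + by apply: (Rfun _ _ _ (fP _)); apply: RD.
  + by apply: (Rfun _ _ _ (fP _)); apply: RM.
- move=> a; have [p pa] := Rtot a.
  by exists (exist _ p (ex_intro _ a pa)); apply: (Rfun _ _ _ (fP _)).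
Qed.

(** * Terms and identities *)

Inductive term := Var of nat | Add of term & term | Mul of term & term.

Fixpoint eval (A : algebra) (e : nat -> A) (t : term) : A :=
  match t with
  | Var i => e i
  | Add s t => sadd (eval e s) (eval e t)
  | Mul s t => smul (eval e s) (eval e t)
  end.

Definition holds (s t : term) : class := fun A => forall e : nat -> A, eval e s = eval e t.

Lemma eval_hom (A B : algebra) (f : A -> B) (e : nat -> A) t :
  is_hom f -> f (eval e t) = eval (fun i => f (e i)) t.
Proof. by move=> [fD fM]; elim: t => //= s <- t <-. Qed.

Lemma holds_variety s t : variety (holds s t).
Proof.
split.
- by move=> A B f hA fh fi e; apply: fi; rewrite !eval_hom.
- move=> A B f hA fh fs e; have [e' e'P] := choice (fun i => fs (e i)).
  have -> : e = (fun i => f (e' i)) by apply/funext => i; rewrite e'P.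
  by rewrite -!eval_hom // hA.
- move=> I A hA e; apply: functional_extensionality_dep => i.
  have pE r : eval e r i = eval (fun k => e k i) r by elim: r => //= ? <- ? <-.
  by rewrite !pE; apply: hA.
Qed.

Lemma holds_generated s t K :
  subclass K (holds s t) -> subclass (generated_variety K) (holds s t).
Proof. exact: generated_variety_min (holds_variety s t). Qed.

(** * Graph semirings *)

Lemma flat_addxx V (x : flat_elt V) : flat_add x x = x.
Proof. by rewrite /flat_add asboolT. Qed.

Lemma flat_add_neq V (x y : flat_elt V) : x <> y -> flat_add x y = Zero.
Proof. by move=> xy; rewrite /flat_add asboolF. Qed.

Lemma flat_add_neq0 V (x y : flat_elt V) : flat_add x y <> Zero -> x = y.
Proof. by move=> h; apply: contrapT => /flat_add_neq. Qed.

Lemma graph_mul_neq0 (G : digraph) (x y : flat_elt G) :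
  graph_mul x y <> Zero ->
  exists a b, [/\ x = Vert a, y = Vert b & edge a b].
Proof.
case: x y => [||a] [||b] //= h; exists a, b; split=> //.
by apply: contrapT => /asboolPn/negPf E; rewrite E in h.
Qed.

Lemma graph_mul_edge (G : digraph) (a b : G) :
  edge a b -> graph_mul (Vert a) (Vert b) = Omega.
Proof. by move=> ab; rewrite /= asboolT. Qed.

Lemma graph_mul_nonedge (G : digraph) (a b : G) :
  ~ edge a b -> graph_mul (Vert a) (Vert b) = Zero.
Proof. by move=> ab; rewrite /= asboolF. Qed.

Lemma graph_mulX0 (G : digraph) (x : flat_elt G) : graph_mul x Zero = Zero.
Proof. by case: x. Qed.

Lemma graph_mulA0 (G : digraph) (x y z : flat_elt G) :
  graph_mul (graph_mul x y) z = Zero.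
Proof. by case: x y => [||a] [||b] //=; case: ifP. Qed.

Lemma graph_mul0A (G : digraph) (x y z : flat_elt G) :
  graph_mul x (graph_mul y z) = Zero.
Proof. by case: x y z => [||a] [||b] [||c] //=; case: ifP. Qed.

(** [admissible] without the clause on isolated vertices: path graphs with one
    vertex and edge-deleted subgraphs satisfy it. *)
Definition unbranched (G : digraph) : Prop :=
  (forall x y z : G, edge x y -> edge x z -> y = z) /\
  (forall x y z : G, edge y x -> edge z x -> y = z).

Lemma flat_addC V : commutative (@flat_add V).
Proof.
move=> x y; case: (pselect (x = y)) => [->//|xy].
by rewrite !flat_add_neq // => yx; apply: xy.
Qed.

Lemma flat_add0x V (x : flat_elt V) : flat_add Zero x = Zero.
Proof. by case: x => [||a]; rewrite ?flat_addxx // flat_add_neq. Qed.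

Lemma flat_addA V : associative (@flat_add V).
Proof.
move=> x y z; case: (pselect (x = y)) => [->|xy].
  case: (pselect (y = z)) => [->|yz]; first by rewrite !flat_addxx.
  by rewrite flat_addxx (flat_add_neq yz) flat_addC flat_add0x.
rewrite (flat_add_neq xy) flat_add0x.
case: (pselect (y = z)) => [<-|yz]; first by rewrite flat_addxx flat_add_neq.
by rewrite (flat_add_neq yz) flat_addC flat_add0x.
Qed.

(** Distributivity is where the degrees matter: if [x z] and [y z] are both
    nonzero then they are omega, and in-degree at most 1 gives [x = y]. *)
Lemma graph_semiring_flat (G : digraph) :
  unbranched G -> flat_semiring (graph_semiring G) /\ nilpotent3 (graph_semiring G).
Proof.
move=> [dout din].
have z0 : is_zero (Zero : graph_semiring G) by split=> x //; apply: graph_mulX0.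
split; last by exists Zero => // x y z; apply: graph_mulA0.
split; last by exists Zero => // x y; apply: flat_add_neq.
split.
- exact: flat_addA.
- exact: flat_addC.
- exact: flat_addxx.
- by move=> x y z /=; rewrite graph_mulA0 graph_mul0A.
- split=> x y z /=.
  + case: (pselect (x = y)) => [->|xy]; first by rewrite !flat_addxx.
    rewrite (flat_add_neq xy) /=; apply: esym; apply: contrapT => h.
    have E := flat_add_neq0 h; rewrite E flat_addxx in h; have [b [c [yb zc bc]]] := graph_mul_neq0 h.
    rewrite -E in h; have [b' [c' [xb' zc' bc']]] := graph_mul_neq0 h.
    by apply: xy; move: zc' bc'; rewrite zc => -[<-] bc'; rewrite xb' yb (din _ _ _ bc bc').
  + case: (pselect (y = z)) => [->|yz]; first by rewrite !flat_addxx.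
    rewrite (flat_add_neq yz) graph_mulX0; apply: esym; apply: contrapT => h.
    have E := flat_add_neq0 h; rewrite E flat_addxx in h; have [b [c [xb zc bc]]] := graph_mul_neq0 h.
    rewrite -E in h; have [b' [c' [xb' yc' bc']]] := graph_mul_neq0 h.
    by apply: yz; move: xb' bc'; rewrite xb => -[<-] bc'; rewrite yc' zc (dout _ _ _ bc bc').
Qed.

Lemma NF3_variety : variety NF3.
Proof. exact: generated_variety_variety. Qed.

Lemma Vac_variety : variety Vac.
Proof.
split.
- by move=> A B f KA fh fi W sW KW; case: (sW) => -[S _ _] _ _; apply: S fh fi; apply: KA.
- by move=> A B f KA fh fs W sW KW; case: (sW) => -[_ H _] _ _; apply: H fh fs; apply: KA.
- by move=> I A KA W sW KW; case: (sW) => -[_ _ P] _ _; apply: P => i; apply: KA.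
Qed.

Lemma admissible_unbranched G : admissible G -> unbranched G.
Proof. by case. Qed.

Lemma graph_semiring_NF3 G : unbranched G -> NF3 (graph_semiring G).
Proof. by move=> /graph_semiring_flat SG; apply: generated_variety_gen. Qed.

Lemma Vac_NF3 : subclass Vac NF3.
Proof.
move=> A; apply; first by split=> //; apply: NF3_variety.
by move=> _ [G [/admissible_unbranched uG _ ->]]; apply: graph_semiring_NF3.
Qed.

Lemma graph_semiring_Vac G : admissible G -> acyclic G -> Vac (graph_semiring G).
Proof. by move=> aG cG W _; apply; exists G. Qed.

(** Intersecting a variety with NF_3 yields one of the subvarieties of NF_3 over
    which V_ac is defined as an intersection. *)
Lemma Vac_min V : variety V ->
  (forall G, admissible G -> acyclic G -> V (graph_semiring G)) ->
  subclass Vac V.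
Proof.
move=> [S H P] VG A VA; have [SN HN PN] := NF3_variety.
suff [] : V A /\ NF3 A by [].
apply: (VA (fun B => V B /\ NF3 B)).
  split; [split | exact: NF3_variety | by move=> B []].
  - move=> B C f [VB NB] fh fi; split; first exact: S VB fh fi.
    exact: SN NB fh fi.
  - move=> B C f [VB NB] fh fs; split; first exact: H VB fh fs.
    exact: HN NB fh fs.
  - by move=> I B VB; split; [apply: P | apply: PN] => i; have [] := VB i.
move=> _ [G [aG cG ->]]; split; first exact: VG.
exact: graph_semiring_NF3 (admissible_unbranched aG).
Qed.

(** The reduced-product form of the embedding criterion, with [ev] the filter of
    sets of indices that are large.  A tuple represents 0 as soon as it is not
    eventually free of zeros: such tuples absorb sums and products because 0
    does so in each coordinate.  A tuple representing a nonzero element has to be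
    eventually equal to the image of that element, and two different elements
    cannot have eventually equal images. *)
Lemma graph_semiring_limit (V : class) (G : digraph) (I : Type)
    (H : I -> digraph) (f : forall i, G -> H i) (ev : (I -> Prop) -> Prop) :
  variety V -> (forall i, V (graph_semiring (H i))) ->
  (forall P Q : I -> Prop, ev P -> (forall i, P i -> Q i) -> ev Q) ->
  (forall P Q : I -> Prop, ev P -> ev Q -> ev (fun i => P i /\ Q i)) ->
  ev (fun _ => True) -> ~ ev (fun _ => False) ->
  (forall x y, edge x y <-> ev (fun i => edge (f i x) (f i y))) ->
  (forall x y, ev (fun i => f i x = f i y) -> x = y) ->
  V (graph_semiring G).
Proof.
move=> vV VH evS evI evT ev0 fE fI.
pose B i := graph_semiring (H i).
pose R (p : product B) (a : graph_semiring G) :=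
  match a with
  | Zero => ~ ev (fun i => p i <> Zero)
  | Omega => ev (fun i => p i = Omega)
  | Vert x => ev (fun i => p i = Vert (f i x))
  end.
have RN0 p a : a <> Zero -> R p a -> ev (fun i => p i = map_vert (f i) a).
  by case: a.
have RE p a : a <> Zero -> ev (fun i => p i = map_vert (f i) a) -> R p a.
  by case: a.
have R0 p a : a <> Zero -> R p a -> ev (fun i => p i <> Zero).
  by move=> a0 /(RN0 _ _ a0) /evS; apply=> i ->; case: a a0.
have Rinj p a b : a <> Zero -> b <> Zero -> R p a -> R p b -> a = b.
  move=> a0 b0 /(RN0 _ _ a0) pa /(RN0 _ _ b0) pb.
  have {pa pb} := evI _ _ pa pb.
  case: a b a0 b0 => [||x] [||y] // _ _ /= h.
  - by case: ev0; apply: (evS _ _ h) => i [->].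
  - by case: ev0; apply: (evS _ _ h) => i [->].
  - by congr Vert; apply: fI; by apply: (evS _ _ h) => i [-> []].
apply: (variety_of_relation (R := R) vV VH).
- move=> p q a b pa qb; rewrite /sadd /=.
  case: (pselect (flat_add a b = Zero)) => [E|/[dup] h /flat_add_neq0 ab].
    rewrite E /= => pq0.
    have pq : ev (fun i => p i = q i) by apply: (evS _ _ pq0) => i; apply: flat_add_neq0.
    have p0 : ev (fun i => p i <> Zero).
      by apply: (evS _ _ pq0) => i h p0; apply: h; rewrite p0 flat_add0x.
    have q0 : ev (fun i => q i <> Zero).
      by apply: (evS _ _ (evI _ _ pq p0)) => i [->].
    have a0 : a <> Zero by move=> a0; rewrite a0 in pa.
    have b0 : b <> Zero by move=> b0; rewrite b0 in qb.
    have pb : R p b.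
      apply: (RE _ _ b0); apply: (evS _ _ (evI _ _ pq (RN0 _ _ b0 qb))) => i.
      by case=> -> ->.
    move: E; rewrite (Rinj _ _ _ a0 b0 pa pb) flat_addxx; exact: b0.
  rewrite -ab flat_addxx in h *.
  have qa : R q a by rewrite ab.
  apply: (RE _ _ h); apply: (evS _ _ (evI _ _ (RN0 _ _ h pa) (RN0 _ _ h qa))).
  by move=> i [-> ->]; apply: flat_addxx.
- move=> p q a b pa qb; rewrite /smul /=.
  case: (pselect (graph_mul a b = Zero)) => [E|/graph_mul_neq0[x [y [ax yb xy]]]].
    rewrite E /= => pq0.
    have p0 : ev (fun i => p i <> Zero).
      by apply: (evS _ _ pq0) => i /graph_mul_neq0[? [? [->]]].
    have q0 : ev (fun i => q i <> Zero).
      by apply: (evS _ _ pq0) => i /graph_mul_neq0[? [? [_ ->]]].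
    have := evI _ _ pq0; case: a pa E => [//||x] pa E.
      move=> /(_ _ pa) h; apply: ev0; apply: (evS _ _ h) => i [h' pO]; apply: h'.
      by rewrite pO.
    move=> /(_ _ pa) h; case: b qb E => [//||y] qb E.
      have := evI _ _ h qb => {}h; apply: ev0; apply: (evS _ _ h) => i [[h' _] qO].
      by apply: h'; rewrite qO; case: (p i).
    have xy : edge x y.
      apply/fE; have := evI _ _ h qb => {}h; apply: (evS _ _ h) => i [[]].
      by move=> /graph_mul_neq0[u [v [-> -> uv]]] [<-] [<-].
    by move: E; rewrite graph_mul_edge.
  rewrite {a}ax {b}yb in pa qb *; rewrite graph_mul_edge //=.
  have /fE h := xy; apply: (evS _ _ (evI _ _ h (evI _ _ pa qb))) => i [e [-> ->]].
  exact: graph_mul_edge.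
- move=> p a b pa pb; case: (pselect (a = Zero)) => [a0|a0].
    case: (pselect (b = Zero)) => [->//|b0]; rewrite a0 in pa.
    by case: pa; apply: R0 pb.
  case: (pselect (b = Zero)) => [b0|b0]; last exact: Rinj pa pb.
  by rewrite b0 in pb; case: pb; apply: R0 pa.
- case=> [||x].
  + by exists (fun i => Zero) => /= h; apply: ev0; apply: (evS _ _ h) => i.
  + by exists (fun i => Omega); apply: (evS _ _ evT).
  + by exists (fun i => Vert (f i x)); apply: (evS _ _ evT).
Qed.

(** The case of the filter whose only large set is the whole index type. *)
Lemma graph_semiring_maps (V : class) (G : digraph) (I : Type) (i0 : I)
    (H : I -> digraph) (f : forall i, G -> H i) :
  variety V -> (forall i, V (graph_semiring (H i))) ->
  (forall i x y, edge x y -> edge (f i x) (f i y)) ->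
  (forall x y, ~ edge x y -> exists i, ~ edge (f i x) (f i y)) ->
  (forall x y, x <> y -> exists i, f i x <> f i y) ->
  V (graph_semiring G).
Proof.
move=> vV VH fE fN fI.
apply: (graph_semiring_limit (f := f) (ev := fun P => forall i, P i) vV VH).
- by move=> P Q hP PQ i; apply: PQ.
- by move=> P Q hP hQ i.
- by [].
- by move=> /(_ i0).
- move=> x y; split=> [xy i|h]; first exact: fE.
  by apply: contrapT => /fN[i]; apply.
- by move=> x y h; apply: contrapT => /fI[i]; apply.
Qed.

Lemma graph_semiring_embed (V : class) (G H : digraph) (f : G -> H) :
  variety V -> V (graph_semiring H) -> injective f ->
  (forall x y, edge x y <-> edge (f x) (f y)) -> V (graph_semiring G).
Proof.
move=> vV VH fI fE; apply: (graph_semiring_maps tt (f := fun=> f)) => //.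
- by move=> _ x y /fE.
- by move=> x y xy; exists tt => /fE.
- by move=> x y xy; exists tt => /fI.
Qed.

(** All products vanish in [S_G], so only the sum matters: a flat semilattice
    embeds into a power of the two-element one {0, omega} by sending each
    nonzero element to the indicator of itself. *)
Lemma edgeless_graph_semiring (V : class) (G H : digraph) :
  variety V -> V (graph_semiring H) -> (forall x y : G, ~ edge x y) ->
  V (graph_semiring G).
Proof.
move=> vV VH nE.
pose f (i x : graph_semiring G) : graph_semiring H :=
  if `[<x = i /\ x <> Zero>] then Omega else Zero.
have fz i : f i Zero = Zero by rewrite /f asboolF // => -[].
have fO i x : f i x <> Zero -> x = i /\ x <> Zero by rewrite /f; case: asboolP.
have fM i x y : graph_mul (f i x) y = Zero by rewrite /f; case: ifP.
have fxx x : x <> Zero -> f x x = Omega by move=> x0; rewrite /f asboolT.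
apply: (variety_subdirect (f := f) vV) => //.
- move=> i; split=> x y /=.
    case: (pselect (x = y)) => [->|nxy]; first by rewrite !flat_addxx.
    rewrite (flat_add_neq nxy) fz; apply: esym; apply: contrapT => h.
    have E := flat_add_neq0 h; rewrite -E flat_addxx in h.
    have [xi _] := fO _ _ h; rewrite E in h; have [yi _] := fO _ _ h.
    by apply: nxy; rewrite xi yi.
  rewrite fM; have -> : graph_mul x y = Zero; last exact: fz.
  by apply: contrapT => /graph_mul_neq0[a [b [_ _ /nE]]].
- move=> x y fxy; case: (pselect (x = Zero)) => [x0|x0].
    case: (pselect (y = Zero)) => [y0|y0]; first by rewrite x0.
    by have := fxy y; rewrite x0 fz fxx.
  have : f x y <> Zero by rewrite -fxy fxx.
  by move=> /fO[].
Qed.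

(** * Walks *)

(** [k] counts edges, so a walk of length [k] runs through [k.+1] vertices. *)
Fixpoint walk (G : digraph) (k : nat) (x y : G) : Prop :=
  if k is k'.+1 then exists2 z, edge x z & walk k' z y else x = y.

Lemma walk_cat (G : digraph) j k (x y z : G) :
  walk j x y -> walk k y z -> walk (j + k) x z.
Proof.
elim: j x => [|j IH] x /=; first by move=> ->.
by move=> [w xw wy] yz; exists w => //; apply: IH.
Qed.

Lemma walk_split (G : digraph) j k (x z : G) :
  walk (j + k) x z -> exists2 y, walk j x y & walk k y z.
Proof.
elim: j x => [|j IH] x /=; first by move=> xz; exists x.
by move=> [w xw /IH[y wy yz]]; exists y => //; exists w.
Qed.

Lemma walk1 (G : digraph) (x y : G) : walk 1 x y <-> edge x y.
Proof. by split=> [[z xz <-]|xy] //; exists y. Qed.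

Lemma walk_rcons (G : digraph) k (x y z : G) :
  walk k x y -> edge y z -> walk k.+1 x z.
Proof. by move=> xy /walk1 yz; rewrite -addn1; apply: walk_cat yz. Qed.

Lemma walk_last (G : digraph) k (x z : G) :
  walk k.+1 x z -> exists2 y, walk k x y & edge y z.
Proof. by rewrite -addn1 => /walk_split[y xy /walk1 yz]; exists y. Qed.

Lemma walk_shorter (G : digraph) j k (x z : G) :
  j <= k -> walk k x z -> exists y, walk j x y.
Proof. by move=> jk; rewrite -(subnKC jk) => /walk_split[y xy _]; exists y. Qed.

Lemma walk_vertices (G : digraph) k (x y : G) :
  walk k x y ->
  exists v : nat -> G, [/\ v 0 = x, v k = y & forall i, i < k -> edge (v i) (v i.+1)].
Proof.
elim: k x => [|k IH] x /=; first by move=> ->; exists (fun=> y).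
move=> [z xz /IH[v [v0 vk vE]]].
exists (fun i => if i is j.+1 then v j else x); split=> // -[|i] ik; last exact: vE.
by rewrite v0.
Qed.

Lemma vertices_walk (G : digraph) (v : nat -> G) k i j :
  (forall i, i < k -> edge (v i) (v i.+1)) -> i <= j <= k -> walk (j - i) (v i) (v j).
Proof.
move=> vE /andP[ij]; rewrite -(subnKC ij) addKn; move: (j - i) => d {ij j}.
elim: d => [|d IH] le; first by rewrite addn0.
by rewrite addnS in le *; apply: (walk_rcons (y := v (i + d))); [apply: IH; lia | apply: vE].
Qed.

(** A shortest closed walk has no repeated vertex, hence is a cycle. *)
Lemma acyclic_walk (G : digraph) k (x : G) : acyclic G -> ~ walk k.+1 x x.
Proof.
move=> aG xx.
have ex : exists k, `[< exists x : G, walk k.+1 x x >] by exists k; apply/asboolP; exists x.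
case: (ex_minnP ex) => m /asboolP[y /walk_vertices[v [v0 vm vE]]] min {k x xx ex}.
have inj i j : i < j -> j <= m -> v i <> v j.
  move=> ij jm vij.
  have := @vertices_walk G v m.+1 i j vE; rewrite (ltnW ij) leqW // -vij => /(_ isT) w.
  suff : m <= (j - i).-1 by lia.
  by apply: min; apply/asboolP; exists (v i); rewrite prednK ?subn_gt0.
apply: (aG m (fun i => v i)); split.
  move=> i j vij; apply: val_inj => /=.
  by case: (ltngtP i j) => // ij; [case: (inj i j) | case: (inj j i)] => //; rewrite -ltnS.
move=> i /=; have := ltn_ord i; rewrite ltnS leq_eqVlt => /orP[/eqP im|im].
  by rewrite im modnn v0 -vm; apply: vE.
by rewrite modn_small //; apply: vE; apply: ltnW.
Qed.

(** The successor of a vertex of largest index cannot have a larger index. *)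
Lemma path_acyclic n : acyclic (path_graph n).
Proof.
move=> m c [_ cE].
case: (@arg_maxnP _ ord0 predT (fun i => c i : nat)) => // i _ /(_ (ordS i) isT).
by rewrite /= (cE i) ltnn.
Qed.

Lemma path_admissible n : admissible (path_graph n.+2).
Proof.
split.
- move=> x; have := ltn_ord x; rewrite leq_eqVlt eqSS => /orP[/eqP xn|xn].
    by exists (inord n); right; rewrite /= inordK.
  by exists (inord x.+1); left; rewrite /= inordK.
- by move=> x y z /= xy xz; apply: val_inj; rewrite /= xy xz.
- by move=> x y z /= yx zx; apply: val_inj; case: (etrans (esym yx) zx).
Qed.

Lemma path_unbranched n : unbranched (path_graph n).
Proof.
split=> x y z /= xy xz; apply: val_inj; first by rewrite /= xy xz.
by case: (etrans (esym xy) xz).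
Qed.

Lemma path_walk n k (x y : path_graph n) : walk k x y -> y = x + k :> nat.
Proof.
elim: k x => [|k IH] x /=; first by move=> ->; rewrite addn0.
by move=> [z xz /IH ->]; rewrite xz addSnnS.
Qed.

Lemma path_no_walk n (x y : path_graph n) : ~ walk n x y.
Proof. by move=> /path_walk e; have := ltn_ord y; rewrite e; lia. Qed.

(** * Disjoint sums, components and gradings *)

Definition disjoint_sum (G H : digraph) : digraph :=
  @Digraph (G + H) (fun x y =>
    match x, y with
    | inl a, inl b => edge a b
    | inr a, inr b => edge a b
    | _, _ => False
    end).

Lemma glued_semiringE G H :
  glued_semiring G H = graph_semiring (disjoint_sum G H).
Proof.
congr (Algebra _ _ _); apply/funext => x; apply/funext => y.
have F : `[<False>] = false by apply: asboolF.
by case: x y => [||[a|a]] [||[b|b]] //=; rewrite ?F //; case: ifP.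
Qed.

Lemma disjoint_sum_unbranched G H :
  unbranched G -> unbranched H -> unbranched (disjoint_sum G H).
Proof.
move=> [oG iG] [oH iH]; split=> -[x|x] [y|y] [z|z] //= xy xz.
- by rewrite (oG _ _ _ xy xz).
- by rewrite (oH _ _ _ xy xz).
- by rewrite (iG _ _ _ xy xz).
- by rewrite (iH _ _ _ xy xz).
Qed.

Lemma disjoint_sum_no_walk (G H : digraph) n :
  (forall x y : G, ~ walk n x y) -> (forall x y : H, ~ walk n x y) ->
  forall x y : disjoint_sum G H, ~ walk n x y.
Proof.
have wl k (a : G) (y : disjoint_sum G H) : walk k (inl a : disjoint_sum G H) y ->
    exists b, walk k a b.
  elim: k a => [|k IH] a /=; first by exists a.
  by move=> [[z|z] //= az /IH[b zb]]; exists b, z.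
have wr k (a : H) (y : disjoint_sum G H) : walk k (inr a : disjoint_sum G H) y ->
    exists b, walk k a b.
  elim: k a => [|k IH] a /=; first by exists a.
  by move=> [[z|z] //= az /IH[b zb]]; exists b, z.
by move=> nG nH [a|a] y => [/wl|/wr] [b]; [apply: nG | apply: nH].
Qed.

Definition edge_closed (G : digraph) (C : G -> Prop) : Prop :=
  forall x y, edge x y -> (C x <-> C y).

Lemma edge_closed_walk (G : digraph) (C : G -> Prop) k x y :
  edge_closed C -> walk k x y -> (C x <-> C y).
Proof.
move=> CE; elim: k x => [|k IH] x /=; first by move=> ->.
by move=> [z /CE xz /IH zy]; rewrite xz.
Qed.

(** The component of [x]: in an unbranched graph, any two vertices of
    a component are joined by a directed walk. *)
Definition line_of (G : digraph) (x y : G) : Prop :=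
  exists k, walk k x y \/ walk k y x.

(** A walk between [x] and an endpoint of an edge either avoids the edge, and then
    extends along it, or runs through it by uniqueness of neighbours. *)
Lemma line_of_closed (G : digraph) (x : G) : unbranched G -> edge_closed (line_of x).
Proof.
move=> [dout din] y z yz; split=> -[k [w|w]].
- by exists k.+1; left; apply: walk_rcons yz.
- case: k w => [|k] /= w; first by exists 1; left; rewrite -w; apply/walk1.
  by case: w => u yu ux; exists k; right; rewrite (dout _ _ _ yz yu).
- case: k w => [|k] w; first by exists 1; right; rewrite /= in w; rewrite w; apply/walk1.
  by case: (walk_last w) => u xu uz; exists k; left; rewrite (din _ _ _ yz uz).
- by exists k.+1; right; exists z.
Qed.

Lemma exists_maximal (P : nat -> Prop) n :
  P 0 -> (forall k, P k -> k <= n) -> exists2 m, P m & forall k, P k -> k <= m.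
Proof.
move=> P0 Pn; have ex : exists k, `[<P k>] by exists 0; apply/asboolP.
have ub k : `[<P k>] -> k <= n by move/asboolP/Pn.
case: (ex_maxnP ex ub) => m /asboolP Pm max; exists m => // k Pk.
by apply: max; apply/asboolP.
Qed.

Section Bounded.
Variables (G : digraph) (n : nat).
Hypotheses (uG : unbranched G) (bG : forall x y : G, ~ walk n.+1 x y).

Lemma bounded_walk k (x y : G) : walk k x y -> k <= n.
Proof.
by move=> xy; rewrite leqNgt; apply/negP => nk; have [z /bG] := walk_shorter nk xy.
Qed.

(** The position of a vertex is the length of the longest walk ending in it, that
    is, its distance from the first vertex of its component. *)
Lemma exists_grading : exists pos : G -> nat,
  [/\ forall x, pos x <= n,
      forall x y, edge x y -> pos y = (pos x).+1 &
      forall x, exists r, walk (pos x) r x].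
Proof.
have mx (x : G) : exists m, (exists r, walk m r x) /\ forall k r, walk k r x -> k <= m.
  have [||m Pm max] := @exists_maximal (fun m => exists r : G, walk m r x) n.
  - by exists x.
  - by move=> k [r /bounded_walk].
  - by exists m; split=> // k r w; apply: max; exists r.
have [pos posP] := choice mx; exists pos; split.
- by move=> x; have [[r /bounded_walk]] := posP x.
- move=> x y xy; have [[r rx] maxx] := posP x; have [[s sy] maxy] := posP y.
  apply/eqP; rewrite eqn_leq (maxy _ r) ?andbT; last exact: walk_rcons xy.
  case E : (pos y) sy => [//|p] /walk_last[z sz zy]; rewrite ltnS; apply: (maxx _ s).
  by case: uG => _ din; rewrite (din _ _ _ xy zy).
- by move=> x; have [] := posP x.
Qed.

End Bounded.

Section Grading.
Variables (G : digraph) (pos : G -> nat).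
Hypothesis posS : forall x y, edge x y -> pos y = (pos x).+1.

Lemma grading_walk k (x y : G) : walk k x y -> pos y = pos x + k.
Proof.
elim: k x => [|k IH] x /=; first by move=> ->; rewrite addn0.
by move=> [z /posS xz /IH ->]; rewrite xz addSnnS.
Qed.

Lemma line_of_inj (x y : G) : line_of x y -> pos x = pos y -> x = y.
Proof.
move=> [[|k] [w|w]] E; [exact: w | exact: esym | |].
- by have := grading_walk w; lia.
- by have := grading_walk w; lia.
Qed.

Lemma line_of_edge (x y : G) : line_of x y -> pos y = (pos x).+1 -> edge x y.
Proof.
move=> [k [w|w]] E; have Ek := grading_walk w; last by lia.
have k1 : k = 1 by lia.
by move: w; rewrite k1 => /walk1.
Qed.

End Grading.

(** * Graphs with bounded walks *)

Definition double_path n := disjoint_sum (path_graph n) (path_graph n).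

Lemma path_edge_inord n i : i < n -> edge (inord i : path_graph n.+1) (inord i.+1).
Proof. by move=> lt_in; rewrite /= !inordK // ltnW. Qed.

Lemma path_edge_inordE n i j : i <= n -> j <= n ->
  edge (inord i : path_graph n.+1) (inord j) <-> j = i.+1.
Proof. by move=> le_i le_j; rewrite /= !inordK. Qed.

Lemma inord_inj n i j : i <= n -> j <= n -> (inord i : 'I_n.+1) = inord j -> i = j.
Proof. by move=> le_i le_j /(f_equal val); rewrite /= !inordK. Qed.

(** Each union [C] of components gives a map that keeps positions, sending
    [C] to the first copy of the path and the rest to the second.  In one
    component equality and edges can be read off from the positions; two different
    components are told apart by taking one of them as [C], as there is no edge
    between the copies. *)
Lemma bounded_graph_semiring_of_double_path (V : class) (G : digraph) n :
  variety V -> V (graph_semiring (double_path n.+1)) ->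
  unbranched G -> (forall x y : G, ~ walk n.+1 x y) -> V (graph_semiring G).
Proof.
move=> vV Vn uG bG; have [pos [pos_n posS _]] := exists_grading uG bG.
pose I := {C : G -> Prop | edge_closed C}.
pose iT : I := exist (@edge_closed G) (fun=> True) (fun x y _ => iff_refl True).
pose f (C : I) (x : G) : double_path n.+1 :=
  if `[<sval C x>] then inl (inord (pos x)) else inr (inord (pos x)).
have sep x y : ~ line_of x y ->
    exists C : I, f C x = inl (inord (pos x)) /\ f C y = inr (inord (pos y)).
  move=> nxy; exists (exist (@edge_closed G) (line_of x) (@line_of_closed G _ uG)).
  rewrite /f /=.
  by rewrite asboolT ?asboolF //; exists 0; left.
apply: (graph_semiring_maps iT (H := fun=> double_path n.+1) (f := f)) => //.
- move=> [C cC] x y xy; rewrite /f /= (asbool_equiv_eq (cC x y xy)).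
  have pxy : edge (inord (pos x) : path_graph n.+1) (inord (pos y)).
    by apply/path_edge_inordE => //; apply: posS.
  by case: ifP.
- move=> x y nxy; case: (pselect (line_of x y)) => [xy|/sep[C [fx fy]]]; last first.
    by exists C; rewrite fx fy.
  exists iT; rewrite /f /= asboolT // => /path_edge_inordE E; apply: nxy.
  by apply: (line_of_edge posS xy); apply: E.
- move=> x y nxy; case: (pselect (line_of x y)) => [xy|/sep[C [fx fy]]]; last first.
    by exists C; rewrite fx fy.
  exists iT; rewrite /f /= asboolT // => -[] /inord_inj E; apply: nxy.
  by apply: (line_of_inj posS xy); apply: E.
Qed.

(** With a single target path, components are told apart by their positions:
    any union of components that do not have [n.+1] vertices may be shifted
    by one.  Of two different components at least one can be shifted, by the
    hypothesis that all walks of length [n] start in the same vertex. *)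
Lemma bounded_graph_semiring_of_path (V : class) (G : digraph) n :
  variety V -> V (graph_semiring (path_graph n.+1)) ->
  unbranched G -> (forall x y : G, ~ walk n.+1 x y) ->
  (forall x x' y y' : G, walk n x x' -> walk n y y' -> x = y) ->
  V (graph_semiring G).
Proof.
move=> vV Vn uG bG uniq_long; have [pos [pos_n posS pos_root]] := exists_grading uG bG.
(* [x] lies in a component with [n.+1] vertices *)
pose long (x : G) := exists r e i j, [/\ walk i r x, walk j x e & i + j = n].
have longE : edge_closed long.
  move=> x y xy; split=> -[r [e [i [j [ri je ij]]]]].
    exists r, e, i.+1, j.-1; case: j je ij => [|j] /= je ij.
      by have := walk_rcons ri xy; rewrite -(addn0 i) ij => /bG.
    case: je => z xz ze; split; last by lia.
      exact: walk_rcons xy.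
    by case: uG => dout _; rewrite (dout _ _ _ xy xz).
  exists r, e, i.-1, j.+1; case: i ri ij => [|i] ri ij.
    by case: (@bG x e); rewrite -ij; exists y.
  case: (walk_last ri) => z rz zy; split; last by rewrite /=; lia.
    by case: uG => _ din; rewrite /= (din _ _ _ xy zy).
  by exists y.
have short_pos x : ~ long x -> pos x < n.
  move=> nx; rewrite ltn_neqAle pos_n andbT; apply/eqP => E; apply: nx.
  by have [r rx] := pos_root x; exists r, x, n, 0; split; rewrite ?addn0 -?E.
have long_line x y : long x -> long y -> line_of x y.
  move=> [r [e [i [j [rx xe ij]]]]] [s [d [i' [j' [sy yd ij']]]]].
  have rs : r = s.
    apply: (uniq_long r e s d); first by rewrite -ij; apply: walk_cat xe.
    by rewrite -ij'; apply: walk_cat yd.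
  have cl := @line_of_closed G x uG.
  apply/(edge_closed_walk cl sy); rewrite -rs; apply/(edge_closed_walk cl rx).
  by exists 0; left.
pose I := {C : G -> Prop | edge_closed C}.
pose sh (C : I) x := pos x + `[<sval C x /\ ~ long x>].
pose f (C : I) (x : G) : path_graph n.+1 := inord (sh C x).
have sh_n C x : sh C x <= n.
  by rewrite /sh; case: asboolP => [[_ /short_pos]|_]; rewrite ?addn0 ?addn1.
pose i0 : I := exist (@edge_closed G) (fun=> False) (fun x y _ => iff_refl False).
have sh0 x : sh i0 x = pos x by rewrite /sh asboolF ?addn0 // => -[].
(* The cases m = 0 and m = 1 separate vertices and refute edges respectively:
   shifting one of the two components destroys an accidental coincidence. *)
have sep x y m : ~ line_of x y -> exists C : I, sh C y <> sh C x + m.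
  move=> nxy; case: (pselect (pos y = pos x + m)) => E; last by exists i0; rewrite !sh0.
  pose C : I := exist (@edge_closed G) (line_of x) (@line_of_closed G _ uG).
  pose D : I := exist (@edge_closed G) (line_of y) (@line_of_closed G _ uG).
  have xx : line_of x x by exists 0; left.
  have yy : line_of y y by exists 0; left.
  have nyx : ~ line_of y x by move=> [k w]; apply: nxy; exists k; case: w; [right | left].
  case: (pselect (long x)) => lx.
    have ly : ~ long y by move=> /(long_line _ _ lx).
    by exists D; rewrite /sh /= asboolT // asboolF; [lia | case].
  by exists C; rewrite /sh /= asboolF ?asboolT //; [lia | case].
apply: (graph_semiring_maps i0 (H := fun=> path_graph n.+1) (f := f)) => //.
- move=> C x y xy; apply/path_edge_inordE => //; rewrite /sh (posS _ _ xy) addSn.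
  congr (_ + nat_of_bool _).+1; apply: asbool_equiv_eq.
  by rewrite (svalP C x y xy) (longE x y xy).
- move=> x y nxy; case: (pselect (line_of x y)) => [xy|/(sep _ _ 1)[C fxy]].
    exists i0; rewrite /f !sh0 => /path_edge_inordE E; apply: nxy.
    by apply: (line_of_edge posS xy); apply: E.
  by exists C => /path_edge_inordE E; apply: fxy; rewrite addn1; apply: E.
- move=> x y nxy; case: (pselect (line_of x y)) => [xy|/(sep _ _ 0)[C fxy]].
    exists i0; rewrite /f !sh0 => /inord_inj E; apply: nxy.
    by apply: (line_of_inj posS xy); apply: E.
  by exists C => /inord_inj E; apply: fxy; rewrite addn0; apply/esym/E.
Qed.

(** * Every variety below NF3 is generated by graph semirings *)

Inductive translation (T : Type) := Id | Lmul of T | Rmul of T.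
Arguments Id {T}.

Definition act (A : algebra) (p : translation A) (x : A) : A :=
  match p with Id => x | Lmul u => smul u x | Rmul u => smul x u end.

Definition act_term (p : translation nat) (t : term) : term :=
  match p with Id => t | Lmul i => Mul (Var i) t | Rmul i => Mul t (Var i) end.

Lemma NF3_holds s t :
  (forall A, flat_semiring A -> nilpotent3 A -> holds s t A) -> subclass NF3 (holds s t).
Proof. by move=> h; apply: holds_generated => A [fA nA]; apply: h. Qed.

Definition env4 (T : Type) (x y u v : T) (i : nat) : T :=
  match i with 0 => x | 1 => y | 2 => u | _ => v end.

Definition flat_lhs p q :=
  Add (Add (act_term p (Var 0)) (act_term p (Var 1))) (act_term q (Var 0)).

(** Order-theoretically: if [p x], [p y] and [q x] are all below [b], then so is
    [q y].  In a flat semiring [p x + p y] is the image of [x + y], which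
    is 0 unless [x = y]. *)
Lemma NF3_flat_law p q :
  subclass NF3 (holds (flat_lhs p q) (Add (flat_lhs p q) (act_term q (Var 1)))).
Proof.
apply: NF3_holds => A [[addA addC addxx mulA [mulDl mulDr]] [z [z0l z0r] zP]] _ e.
have addz x : sadd z x = z.
  by case: (pselect (z = x)) => [<-|/zP//]; rewrite addxx.
rewrite /flat_lhs /=; case: (pselect (e 0 = e 1)) => [E|ne].
  have -> : eval e (act_term q (Var 1)) = eval e (act_term q (Var 0)).
    by case: q => [|i|i] /=; rewrite E.
  by rewrite -!addA addxx.
suff -> : sadd (eval e (act_term p (Var 0))) (eval e (act_term p (Var 1))) = z.
  by rewrite !addz.
by case: p => [|i|i] /=; rewrite -?mulDl -?mulDr (zP _ _ ne) ?z0l ?z0r.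
Qed.

Section Laws.
Variables (A : algebra) (NA : NF3 A).

Lemma NF3_eq s t (e : nat -> A) :
  (forall B, flat_semiring B -> nilpotent3 B -> holds s t B) -> eval e s = eval e t.
Proof. by move=> h; apply: (NF3_holds h). Qed.

Lemma NF3_addA : associative (@sadd A).
Proof.
move=> x y z.
apply: (@NF3_eq (Add (Var 0) (Add (Var 1) (Var 2)))
  (Add (Add (Var 0) (Var 1)) (Var 2)) (env4 x y z z)).
by move=> B [[h *]] *; move=> e; apply: h.
Qed.

Lemma NF3_addC : commutative (@sadd A).
Proof.
move=> x y.
apply: (@NF3_eq (Add (Var 0) (Var 1)) (Add (Var 1) (Var 0)) (env4 x y x y)).
by move=> B [[_ h *]] *; move=> e; apply: h.
Qed.

Lemma NF3_addxx : idempotent_op (@sadd A).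
Proof.
move=> x.
apply: (@NF3_eq (Add (Var 0) (Var 0)) (Var 0) (env4 x x x x)).
by move=> B [[_ _ h *]] *; move=> e; apply: h.
Qed.

Lemma NF3_mulA : associative (@smul A).
Proof.
move=> x y z.
apply: (@NF3_eq (Mul (Var 0) (Mul (Var 1) (Var 2)))
  (Mul (Mul (Var 0) (Var 1)) (Var 2)) (env4 x y z z)).
by move=> B [[_ _ _ h *]] *; move=> e; apply: h.
Qed.

Lemma NF3_mulDl : left_distributive (@smul A) (@sadd A).
Proof.
move=> x y z.
apply: (@NF3_eq (Mul (Add (Var 0) (Var 1)) (Var 2))
  (Add (Mul (Var 0) (Var 2)) (Mul (Var 1) (Var 2))) (env4 x y z z)).
by move=> B [[_ _ _ _ [h *]]] *; move=> e; apply: h.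
Qed.

Lemma NF3_mulDr : right_distributive (@smul A) (@sadd A).
Proof.
move=> x y z.
apply: (@NF3_eq (Mul (Var 0) (Add (Var 1) (Var 2)))
  (Add (Mul (Var 0) (Var 1)) (Mul (Var 0) (Var 2))) (env4 x y z z)).
by move=> B [[_ _ _ _ [_ h]]] *; move=> e; apply: h.
Qed.

Lemma NF3_triple_top (x y z t : A) :
  sadd t (smul (smul x y) z) = smul (smul x y) z.
Proof.
apply: (@NF3_eq (Add (Var 3) (Mul (Mul (Var 0) (Var 1)) (Var 2)))
  (Mul (Mul (Var 0) (Var 1)) (Var 2)) (env4 x y z t)).
move=> B [[_ _ addxx _ _] [z0 [z0l z0r] zP]] [z1 [z1l z1r] nil] e /=; rewrite nil.
have -> : z1 = z0 by rewrite -(z0l z1) z1r.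
by case: (pselect (e 3 = z0)) => [->|/zP].
Qed.

(** In a flat nilpotent semiring [x = x u] forces [x = x u u = 0]; the right-hand
    side is just a name for 0. *)
Lemma NF3_add_mulr (x u : A) : sadd x (smul x u) = smul (smul x x) x.
Proof.
apply: (@NF3_eq (Add (Var 0) (Mul (Var 0) (Var 1)))
  (Mul (Mul (Var 0) (Var 0)) (Var 0)) (env4 x u x x)).
move=> B [[_ _ addxx _ _] [z0 [z0l z0r] zP]] [z1 [z1l z1r] nil] e /=; rewrite nil.
have E : z1 = z0 by rewrite -(z0l z1) z1r.
case: (pselect (e 0 = smul (e 0) (e 1))) => [h|/zP ->//].
by rewrite -h addxx h {1}h nil.
Qed.

Lemma NF3_add_mull (x u : A) : sadd x (smul u x) = smul (smul x x) x.
Proof.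
apply: (@NF3_eq (Add (Var 0) (Mul (Var 1) (Var 0)))
  (Mul (Mul (Var 0) (Var 0)) (Var 0)) (env4 x u x x)).
move=> B [[_ _ addxx mulA _] [z0 [z0l z0r] zP]] [z1 [z1l z1r] nil] e /=; rewrite nil.
have E : z1 = z0 by rewrite -(z0l z1) z1r.
case: (pselect (e 0 = smul (e 1) (e 0))) => [h|/zP ->//].
by rewrite -h addxx h {1}h mulA nil.
Qed.

Lemma NF3_flat (p q : translation A) x y :
  let s := sadd (sadd (act p x) (act p y)) (act q x) in
  s = sadd s (act q y).
Proof.
pose code (i : nat) (p : translation A) : translation nat :=
  match p with Id => Id | Lmul _ => Lmul i | Rmul _ => Rmul i end.
pose par (p : translation A) := match p with Id => x | Lmul u => u | Rmul u => u end.
have := @NF3_flat_law (code 2 p) (code 3 q) A NA (env4 x y (par p) (par q)).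
by case: p q => [|u|u] [|v|v].
Qed.

End Laws.

(** The syntactic congruence of the principal ideal [{x | x <= b}]. *)
Section Syntactic.
Variables (A : algebra) (NA : NF3 A) (b : A).
Hypothesis b_top : exists t, sadd t b <> b.

Let le (x : A) := sadd x b = b.

Let leD x y : le (sadd x y) <-> le x /\ le y.
Proof.
rewrite /le; split=> [xy|[xb yb]]; last by rewrite -(NF3_addA NA) yb.
split; rewrite -xy (NF3_addA NA).
  by rewrite (NF3_addA NA x) (NF3_addxx NA).
by rewrite (NF3_addC NA x) (NF3_addA NA y) (NF3_addxx NA).
Qed.

Let le_triple x y z : ~ le (smul (smul x y) z).
Proof.
move=> h; have [t] := b_top; apply.
by rewrite -h (NF3_addA NA) (NF3_triple_top NA).
Qed.

(* [live] elements have a nonzero class. *)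
Let live (x : A) := exists p : translation A, le (act p x).
Let sim (x y : A) := forall p : translation A, le (act p x) <-> le (act p y).

Let act_add (p : translation A) x y : act p (sadd x y) = sadd (act p x) (act p y).
Proof. by case: p => [|u|u] //=; rewrite ?(NF3_mulDr NA) ?(NF3_mulDl NA). Qed.

Let live_add x y : live (sadd x y) -> sim x y.
Proof.
move=> [p]; rewrite act_add => /leD[px py] q; split=> h.
  have := NF3_flat NA p q x y; set s := sadd (sadd _ _) _ => /= E.
  have : le s by rewrite /s leD leD.
  by rewrite E leD => -[].
have := NF3_flat NA p q y x; set s := sadd (sadd _ _) _ => /= E.
have : le s by rewrite /s leD leD.
by rewrite E leD => -[].
Qed.

Let sim_live x y : live x -> sim x y -> live (sadd x y).
Proof. by move=> [p px] xy; exists p; rewrite act_add leD -xy. Qed.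

(* The classes of [inner] elements are the vertices. *)
Let inner x := exists2 p : translation A, p <> Id & le (act p x).

(** No vertex is below [b]: otherwise [b] would lie above some [x + x u] or
    [x + u x], which is the top. *)
Let inner_le x : inner x -> ~ le x.
Proof.
move=> [[|u|u] // _] /= h xb.
  have : le (sadd x (smul u x)) by rewrite leD.
  by rewrite (NF3_add_mull NA); apply: le_triple.
have : le (sadd x (smul x u)) by rewrite leD.
by rewrite (NF3_add_mulr NA); apply: le_triple.
Qed.

Let le_sim x y : le x -> le y -> sim x y.
Proof. by move=> xb yb; apply: live_add; exists Id; rewrite /= leD. Qed.

(** Classes are represented by predicates, which avoids quotient types. *)
Definition syntactic_graph : digraph :=
  @Digraph {P : A -> Prop | exists2 x, inner x & P = sim x}
    (fun P Q => exists x y, [/\ sval P = sim x, sval Q = sim y & le (smul x y)]).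

Let vert x (h : inner x) : syntactic_graph :=
  exist _ (sim x) (ex_intro2 _ _ x h erefl).

Let quot (x : A) : graph_semiring syntactic_graph :=
  if `[<le x>] then Omega else
  if pselect (inner x) is left h then Vert (vert h) else Zero.

Let sim_eq x y : sim x = sim y <-> sim x y.
Proof.
split=> [->//|xy]; apply/funext => z; apply/propext.
by split=> h p; rewrite -?h xy // -h.
Qed.

Let vert_eq x y (hx : inner x) (hy : inner y) : vert hx = vert hy <-> sim x y.
Proof.
by rewrite -sim_eq; split=> [[]//|e]; apply: eq_exist.
Qed.

Let edge_vert x y (hx : inner x) (hy : inner y) :
  edge (vert hx) (vert hy) <-> le (smul x y).
Proof.
split=> [[x' [y' /= [/sim_eq xx' /sim_eq yy' h]]]|h]; last by exists x, y.
by have /= -> := xx' (Rmul y); have /= -> := yy' (Lmul x').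
Qed.

Let quot_le x : quot x = Omega <-> le x.
Proof.
by rewrite /quot; case: asboolP => // nx; split=> //; case: pselect.
Qed.

Let quot_inner x (h : inner x) : quot x = Vert (vert h).
Proof.
rewrite /quot asboolF; last exact: inner_le.
by case: pselect => // h'; congr Vert; apply/vert_eq.
Qed.

Let liveE x : live x <-> le x \/ inner x.
Proof.
split=> [[p px]|[h|[p _ h]]]; [|by exists Id|by exists p].
by case: p px => [|u|u] /= h; [left | right; exists (Lmul u) | right; exists (Rmul u)].
Qed.

Let quot_dead x : ~ live x -> quot x = Zero.
Proof.
rewrite liveE /quot => nx; case: asboolP => [?|_]; first by case: nx; left.
by case: pselect => // ?; case: nx; right.
Qed.

Let quot_eq x y : live x -> quot x = quot y <-> live y /\ sim x y.
Proof.
move=> lx; split=> [E|[_ xy]]; last first.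
  case/liveE: (lx) => [xb|ix].
    by have /= yb := xy Id; rewrite (proj2 (quot_le x)) ?(proj2 (quot_le y)) // -yb.
  have iy : inner y by case: ix => p p1 px; exists p; rewrite // -xy.
  by rewrite (quot_inner ix) (quot_inner iy); congr Vert; apply/vert_eq.
case/liveE: lx => [xb|ix].
  have yb : le y by apply/quot_le; rewrite -E; apply/quot_le.
  by split; [apply/liveE; left | apply: le_sim].
rewrite (quot_inner ix) in E.
case: (pselect (live y)) => [/[dup] ly /liveE[/quot_le yb|iy]|/quot_dead y0].
- by rewrite yb in E.
- by move: E; rewrite (quot_inner iy) => -[/sim_eq].
- by rewrite y0 in E.
Qed.

Let quotD x y : quot (sadd x y) = flat_add (quot x) (quot y).
Proof.
case: (pselect (live (sadd x y))) => [l|nl].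
  have xy := live_add l.
  have [lx ly] : live x /\ live y.
    by case: l => p; rewrite act_add leD => -[? ?]; split; exists p.
  have <- : quot x = quot y by apply/quot_eq.
  rewrite flat_addxx; apply/esym/quot_eq => //; split=> // p.
  by rewrite act_add leD -xy; split=> [|[]].
rewrite (quot_dead nl); apply: esym; apply: contrapT => h; have E := flat_add_neq0 h.
case: (pselect (live x)) => [lx|/quot_dead x0]; last by rewrite -E x0 flat_addxx in h.
by apply: nl; apply: sim_live => //; have [] := proj1 (quot_eq y lx) E.
Qed.

Let quotM x y : quot (smul x y) = graph_mul (quot x) (quot y).
Proof.
case: (pselect (le (smul x y))) => [xy|nxy].
  have ix : inner x by exists (Rmul y).
  have iy : inner y by exists (Lmul x).
  rewrite (quot_inner ix) (quot_inner iy) graph_mul_edge ?(proj2 (quot_le _)) //.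
  exact/edge_vert.
rewrite quot_dead; last first.
  case/liveE => // -[[|u|u] // _] /=; first by rewrite (NF3_mulA NA); apply: le_triple.
  exact: le_triple.
apply: esym; apply: contrapT => /graph_mul_neq0[P [Q [xP yQ PQ]]].
have ix : inner x.
  apply: contrapT => nx; move: xP; rewrite /quot; case: asboolP => // _.
  by case: pselect.
have iy : inner y.
  apply: contrapT => ny; move: yQ; rewrite /quot; case: asboolP => // _.
  by case: pselect.
move: xP yQ; rewrite (quot_inner ix) (quot_inner iy) => -[EP] [EQ].
by apply: nxy; apply/(edge_vert ix iy); rewrite EP EQ.
Qed.

Lemma syntactic_graph_unbranched : unbranched syntactic_graph.
Proof.
have vertP (P : syntactic_graph) : exists x (h : inner x), P = vert h.
  by case: P => P [x h e]; exists x, h; apply: eq_exist.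
split=> X Y Z; have [x [hx ->]] := vertP X; have [y [hy ->]] := vertP Y;
  have [z [hz ->]] := vertP Z => /edge_vert h1 /edge_vert h2; apply/vert_eq.
- by apply: live_add; exists (Lmul x); rewrite act_add leD.
- by apply: live_add; exists (Rmul x); rewrite act_add leD.
Qed.

Lemma syntactic_quotient :
  exists f : A -> graph_semiring syntactic_graph,
  [/\ is_hom f, forall y, exists x, f x = y & forall x, f x = Omega <-> le x].
Proof.
exists quot; split; [by split; [exact: quotD | exact: quotM] | | exact: quot_le].
case=> [||[P [x h e]]].
- exists (smul (smul b b) b); apply: quot_dead; case/liveE; first exact: le_triple.
  move=> [[|u|u] // _] /=; last by rewrite -(NF3_mulA NA); apply: le_triple.
  by rewrite (NF3_mulA NA); apply: le_triple.
- by exists b; apply/quot_le; apply: NF3_addxx.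
- by exists x; rewrite (quot_inner h); congr Vert; apply: eq_exist.
Qed.

End Syntactic.

(** If [x <= y] fails, the quotient at [y] sends [y], but not [x], to omega;
    so the quotients of an algebra separate its points. *)
Lemma variety_graph_generated V W : variety V -> variety W -> subclass W NF3 ->
  (forall G, unbranched G -> W (graph_semiring G) -> V (graph_semiring G)) ->
  subclass W V.
Proof.
move=> vV vW WN WV A WA; have NA := WN _ WA.
pose le (x y : A) := sadd x y = y.
have leT x y : ~ le x y -> exists t, sadd t y <> y by exists x.
pose I := {b : A | exists t, sadd t b <> b}.
pose H (b : I) := syntactic_graph (sval b).
have quot (b : I) := syntactic_quotient NA (svalP b).
pose f (b : I) : A -> graph_semiring (H b) := sval (cid (quot b)).
have fP (b : I) : [/\ is_hom (f b), forall y, exists x, f b x = y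
    & forall x, f b x = Omega <-> le x (sval b)] by rewrite /f; case: cid.
apply: (variety_subdirect (f := f) vV).
- move=> b; apply: (WV (H b)); first exact: (syntactic_graph_unbranched NA (sval b)).
  by case: vW => _ quotW _; have [fh fs _] := fP b; apply: quotW fh fs.
- by move=> b; have [] := fP b.
- have le_of x y : (forall i, f i x = f i y) -> le x y.
    move=> fxy; apply: contrapT => /[dup] nxy /leT yT.
    have [_ _ fO] := fP (exist _ y yT); apply: nxy; apply/fO; rewrite fxy; apply/fO.
    exact: NF3_addxx.
  move=> x y fxy; rewrite -(le_of x y fxy) (NF3_addC NA).
  by rewrite (le_of y x (fun i => esym (fxy i))).
Qed.

(** * Embedding paths *)

(** Any further coincidence or edge between vertices of a walk would close a cycle. *)
Lemma vertices_edge (G : digraph) (v : nat -> G) n i j :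
  unbranched G -> acyclic G -> (forall i, i < n -> edge (v i) (v i.+1)) ->
  i <= n -> j <= n -> (v i = v j <-> i = j) /\ (edge (v i) (v j) <-> j = i.+1).
Proof.
move=> [dout din] aG vE.
have inj i' j' : i' <= n -> j' <= n -> v i' = v j' -> i' = j'.
  have lt_neq a c : a < c -> c <= n -> v a <> v c.
    move=> ac cn E; have := @vertices_walk G v n a c vE; rewrite (ltnW ac) cn => /(_ isT).
    by rewrite E -(subnSK ac) => /(acyclic_walk aG).
  move=> i'n j'n E; case: (ltngtP i' j') => // h.
    by case: (lt_neq _ _ h j'n).
  by case: (lt_neq _ _ h i'n).
move=> le_i le_j; split; split=> [E|E].
- exact: inj.
- by rewrite E.
- move: le_i; rewrite leq_eqVlt => /orP[/eqP i_n|lt_i]; last first.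
    by apply: inj => //; apply: dout E _; apply: vE.
  case: (@acyclic_walk G (n - j) (v j) aG); rewrite -subSn //.
  have := @vertices_walk G v n j n vE; rewrite le_j leqnn => /(_ isT) w.
  by rewrite subSn //; apply: walk_rcons w _; rewrite -i_n.
- by rewrite E; apply: vE; rewrite -E.
Qed.

Lemma path_embeds (V : class) (G : digraph) n (x y : G) :
  variety V -> V (graph_semiring G) -> unbranched G -> acyclic G -> walk n x y ->
  V (graph_semiring (path_graph n.+1)).
Proof.
move=> vV VG uG aG /walk_vertices[v [_ _ vE]].
have le_n (i : 'I_n.+1) : i <= n by rewrite -ltnS.
apply: (graph_semiring_embed (f := fun i : path_graph n.+1 => v i) vV VG).
  move=> i j vij; apply: val_inj.
  exact: (proj1 (proj1 (vertices_edge uG aG vE (le_n i) (le_n j))) vij).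
move=> i j; apply: iff_sym.
exact: (proj2 (vertices_edge uG aG vE (le_n i) (le_n j))).
Qed.

(** Two walks of maximal length with different first vertices are disjoint and not
    joined by edges: positions reduce a meeting to one at equal indices,
    which propagates back to the first vertices by uniqueness of predecessors. *)
Lemma double_path_embeds (V : class) (G : digraph) n (x x' y y' : G) :
  variety V -> V (graph_semiring G) -> unbranched G -> acyclic G ->
  (forall u w : G, ~ walk n.+1 u w) ->
  walk n x x' -> walk n y y' -> x <> y ->
  V (graph_semiring (double_path n.+1)).
Proof.
move=> vV VG uG aG bG xx' yy' nxy.
have [pos [pos_n posS _]] := exists_grading uG bG.
have pos0 z z' : walk n z z' -> pos z = 0.
  by move=> /(grading_walk posS); have := pos_n z'; lia.
have [v [v0 _ vE]] := walk_vertices xx'; have [w [w0 _ wE]] := walk_vertices yy'.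
have le_n (i : 'I_n.+1) : i <= n by rewrite -ltnS.
have pos_v (u : nat -> G) i :
    pos (u 0) = 0 -> (forall i, i < n -> edge (u i) (u i.+1)) -> i <= n -> pos (u i) = i.
  move=> u0 uE le_i; have := @vertices_walk G u n 0 i uE; rewrite le_i => /(_ isT).
  by move=> /(grading_walk posS) ->; rewrite u0 subn0.
have vi i : i <= n -> pos (v i) = i by apply: pos_v; rewrite ?v0 ?(pos0 _ _ xx').
have wi i : i <= n -> pos (w i) = i by apply: pos_v; rewrite ?w0 ?(pos0 _ _ yy').
have vw i : i <= n -> v i <> w i.
  elim: i => [|i IH] lt_i; first by rewrite v0 w0.
  move=> E; apply: IH (ltnW lt_i) _; case: uG => _ din; apply: din (vE _ lt_i) _.
  by rewrite E; apply: wE.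
have vw' i j : i <= n -> j <= n -> v i <> w j.
  move=> le_i le_j E; have := vi _ le_i; rewrite E wi // => ji.
  by apply: (vw i le_i); rewrite E ji.
have nvw i j : i <= n -> j <= n -> ~ edge (v i) (w j) /\ ~ edge (w j) (v i).
  move=> le_i le_j; split=> E; have := posS _ _ E; rewrite vi // wi // => ij.
    have lt_i : i < n by rewrite -ij.
    case: uG => dout _; case: (vw i.+1 lt_i); rewrite (dout _ _ _ (vE _ lt_i) E).
    by rewrite ij.
  have lt_j : j < n by rewrite -ij.
  case: uG => dout _; case: (vw j.+1 lt_j); rewrite (dout _ _ _ (wE _ lt_j) E).
  by rewrite ij.
pose f (i : double_path n.+1) := match i with inl i => v i | inr i => w i end.
apply: (graph_semiring_embed (f := f) vV VG).
  move=> [i|i] [j|j] /= E.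
  - congr inl; apply: val_inj.
    exact: (proj1 (proj1 (vertices_edge uG aG vE (le_n i) (le_n j))) E).
  - by case: (vw' i j).
  - by case: (vw' j i).
  - congr inr; apply: val_inj.
    exact: (proj1 (proj1 (vertices_edge uG aG wE (le_n i) (le_n j))) E).
move=> [i|i] [j|j] /=.
- exact: iff_sym (proj2 (vertices_edge uG aG vE (le_n i) (le_n j))).
- by split=> // E; have [h _] := nvw i j (le_n i) (le_n j); apply: h.
- by split=> // E; have [_ h] := nvw j i (le_n j) (le_n i); apply: h.
- exact: iff_sym (proj2 (vertices_edge uG aG wE (le_n i) (le_n j))).
Qed.

(** * Identities that separate the varieties *)

Fixpoint edge_sum (s t : nat -> nat) (n : nat) : term :=
  let m := Mul (Var (s n)) (Var (t n)) in
  if n is n'.+1 then Add (edge_sum s t n') m else m.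

Lemma edge_sum_edges (G : digraph) (e : nat -> graph_semiring G) s t n v :
  (forall i, i <= n -> e (s i) = Vert (v (s i))) ->
  (forall i, i <= n -> e (t i) = Vert (v (t i))) ->
  (forall i, i <= n -> edge (v (s i)) (v (t i))) ->
  eval e (edge_sum s t n) = Omega.
Proof.
elim: n => [|n IH] es et vE.
  by rewrite /= es // et //; apply: graph_mul_edge; apply: vE.
rewrite [edge_sum _ _ _]/= [LHS]/= es // et // -/(graph_mul _ _) graph_mul_edge; last exact: vE.
rewrite IH; first exact: flat_addxx.
- by move=> i le_i; apply: es; apply: leqW.
- by move=> i le_i; apply: et; apply: leqW.
- by move=> i le_i; apply: vE; apply: leqW.
Qed.

(** A sum in a flat semiring is nonzero only if all its summands agree, and the
    only nonzero product is omega. *)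
Lemma edge_sum_neq0 (G : digraph) (e : nat -> graph_semiring G) s t n :
  eval e (edge_sum s t n) <> Zero ->
  exists v : nat -> G,
    forall i, i <= n -> [/\ e (s i) = Vert (v (s i)), e (t i) = Vert (v (t i)) &
                            edge (v (s i)) (v (t i))].
Proof.
move=> h.
have E i : i <= n -> exists a b, [/\ e (s i) = Vert a, e (t i) = Vert b & edge a b].
  elim: n h => [|n IH] h.
    by rewrite leqn0 => /eqP ->; apply: graph_mul_neq0 h.
  have eq := flat_add_neq0 h; rewrite /= -/eval in h.
  have h1 : eval e (edge_sum s t n) <> Zero.
    by move=> z; apply: h; rewrite /= z; apply: flat_add0x.
  rewrite leq_eqVlt => /orP[/eqP ->|]; last exact: IH.
  by apply: graph_mul_neq0; rewrite -[graph_mul _ _]eq.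
have [a0 _] := E 0 isT.
exists (fun k => if e k is Vert a then a else a0) => i /E[a [b [-> -> ab]]].
by split.
Qed.

Definition zero_term := Mul (Mul (Var 0) (Var 0)) (Var 0).

Lemma eval_zero_term (G : digraph) (e : nat -> graph_semiring G) : eval e zero_term = Zero.
Proof. exact: graph_mulA0. Qed.

Definition no_walk_law n := holds (edge_sum id succn n) zero_term.

Lemma no_walk_holds (G : digraph) n :
  (forall x y : G, ~ walk n.+1 x y) -> no_walk_law n (graph_semiring G).
Proof.
move=> nG e; rewrite eval_zero_term; apply: contrapT => /edge_sum_neq0[v vP].
have vE i : i < n.+1 -> edge (v i) (v i.+1) by rewrite ltnS => /vP[].
have := @vertices_walk G v n.+1 0 n.+1 vE; rewrite leqnn subn0 => /(_ isT).
exact: nG.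
Qed.

Lemma path_breaks_law n : ~ no_walk_law n (graph_semiring (path_graph n.+2)).
Proof.
move=> h; have := h (fun i => Vert (inord i)); rewrite eval_zero_term.
rewrite (@edge_sum_edges _ _ _ _ _ (fun i => inord i : path_graph n.+2)) // => i le_i.
by apply: path_edge_inord.
Qed.

Definition no_cycle_law n :=
  holds (edge_sum id (fun i => i.+1 %% n.+1) n) zero_term.

Lemma acyclic_no_cycle (G : digraph) n : acyclic G -> no_cycle_law n (graph_semiring G).
Proof.
move=> aG e; rewrite eval_zero_term; apply: contrapT => /edge_sum_neq0[v vP].
have vE i : i < n -> edge (v i) (v i.+1).
  by move=> lt_i; have [_ _] := vP i (ltnW lt_i); rewrite modn_small.
have [_ _ vn] := vP n (leqnn n); rewrite modnn in vn.
have := @vertices_walk G v n 0 n vE; rewrite leqnn subn0 => /(_ isT) w.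
exact: acyclic_walk aG (walk_rcons w vn).
Qed.

Lemma no_cycle_acyclic (G : digraph) :
  (forall n, no_cycle_law n (graph_semiring G)) -> acyclic G.
Proof.
move=> h n c [_ cE]; have := h n (fun i => Vert (c (inord i))); rewrite eval_zero_term.
rewrite (@edge_sum_edges _ _ _ _ _ (fun i => c (inord i))) // => i le_i.
have -> : (inord (i.+1 %% n.+1) : 'I_n.+1) = ordS (inord i); last exact: cE.
by apply: val_inj; rewrite /= !inordK // ltn_mod.
Qed.

Lemma Vac_acyclic (G : digraph) : Vac (graph_semiring G) -> acyclic G.
Proof.
move=> VG; apply: no_cycle_acyclic => n; apply: (Vac_min _ _ VG).
  exact: holds_variety.
by move=> H _ aH; apply: acyclic_no_cycle.
Qed.

(** The second walk uses the variables from [n.+2] on; [n.+2 + 1] is the index of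
    its second vertex. *)
Definition two_walks n :=
  Add (edge_sum id succn n) (edge_sum (addn n.+2) (fun i => n.+2 + i.+1) n).

Definition merge_law n :=
  holds (two_walks n) (Add (two_walks n) (Mul (Var 0) (Var (n.+2 + 1)))).

(** A walk with [n.+1] edges in a path with [n.+2] vertices starts at the first
    vertex, so both walks are the whole path. *)
Lemma path_merge n : merge_law n (graph_semiring (path_graph n.+2)).
Proof.
move=> e; set s := eval e (two_walks n).
rewrite -[RHS]/(flat_add s (graph_mul (e 0) (e (n.+2 + 1)))).
case: (pselect (s = Zero)) => [->|h]; first by rewrite flat_add0x.
have E : eval e (edge_sum id succn n) =
    eval e (edge_sum (addn n.+2) (fun i => n.+2 + i.+1) n) := flat_add_neq0 h.
have h1 : eval e (edge_sum id succn n) <> Zero.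
  by move=> z; apply: h; rewrite /s /= z flat_add0x.
have h2 := h1; rewrite E in h2.
have [v vP] := edge_sum_neq0 h1; have [w wP] := edge_sum_neq0 h2.
have sO : s = Omega.
  rewrite /s /= -E flat_addxx.
  by apply: (@edge_sum_edges _ _ _ _ _ v) => i /vP[].
have v0 : v 0 = 0 :> nat.
  have vE i : i < n.+1 -> edge (v i) (v i.+1) by rewrite ltnS => /vP[].
  have := @vertices_walk _ v n.+1 0 n.+1 vE; rewrite leqnn subn0 => /(_ isT) /path_walk.
  by have := ltn_ord (v n.+1); lia.
have w0 : w (n.+2 + 0) = 0 :> nat.
  pose w' i := w (n.+2 + i).
  have wE i : i < n.+1 -> edge (w' i) (w' i.+1) by rewrite ltnS => /wP[].
  have := @vertices_walk _ w' n.+1 0 n.+1 wE; rewrite leqnn subn0 => /(_ isT) /path_walk.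
  by have := ltn_ord (w' n.+1); rewrite /w'; lia.
have [-> _ _] := vP 0 isT; have [_ -> w01] := wP 0 isT.
by rewrite graph_mul_edge ?sO ?flat_addxx //= w01 w0 v0.
Qed.

Lemma double_path_no_merge n : ~ merge_law n (graph_semiring (double_path n.+2)).
Proof.
pose P := path_graph n.+2.
pose v k : double_path n.+2 :=
  if k < n.+2 then inl (inord k : P) else inr (inord (k - n.+2) : P).
have vl k : k <= n.+1 -> v k = inl (inord k : P) by move=> kn; rewrite /v ltnS kn.
have vr k : v (n.+2 + k) = inr (inord k : P) by rewrite /v ltnNge leq_addr addKn.
pose e k : graph_semiring (double_path n.+2) := Vert (v k).
have sO : eval e (two_walks n) = Omega.
  rewrite /= !(@edge_sum_edges _ _ _ _ _ v) ?flat_addxx // => i le_i.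
    by rewrite !vr; apply: path_edge_inord.
  by rewrite !vl ?ltnS ?leqW //; apply: path_edge_inord.
move=> h; have : eval e (two_walks n) =
  flat_add (eval e (two_walks n)) (graph_mul (e 0) (e (n.+2 + 1))) := h e.
by rewrite sO /e vl // vr graph_mul_nonedge // flat_add_neq.
Qed.

(** * Acyclic graphs as limits *)

Definition cut (G : digraph) (F : seq {classic G}) : digraph :=
  @Digraph G (fun x y => edge x y /\ (x : {classic G}) \in F).

(** The sources of the edges of a walk are distinct because [G] is acyclic, and in
    [cut F] they all belong to [F]. *)
Lemma cut_no_walk (G : digraph) (F : seq {classic G}) :
  unbranched G -> acyclic G -> forall x y : cut F, ~ walk (size F).+1 x y.
Proof.
move=> uG aG x y /walk_vertices[v [_ _ vE]].
have vG i : i < (size F).+1 -> @edge G (v i) (v i.+1) by move=> /vE[].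
pose s : seq {classic G} := [seq v i | i <- iota 0 (size F).+1].
have us : uniq s.
  rewrite map_inj_in_uniq ?iota_uniq // => i j; rewrite !mem_iota !add0n => /= lt_i lt_j.
  exact: (proj1 (proj1 (vertices_edge uG aG vG (ltnW lt_i) (ltnW lt_j)))).
have sF : {subset s <= F}.
  by move=> z /mapP[i]; rewrite mem_iota add0n => /= /vE[_ iF] ->.
by have := uniq_leq_size us sF; rewrite size_map size_iota ltnn.
Qed.

(** [S_G] is the limit of the semirings of its cuts along the filter of large
    finite sets: each edge is eventually kept. *)
Lemma paths_generate_Vac V : variety V ->
  (forall n, V (graph_semiring (path_graph n.+1))) -> subclass Vac V.
Proof.
move=> vV Vp; apply: (Vac_min vV) => G /admissible_unbranched uG aG.
apply: (graph_semiring_limit (H := @cut G) (f := fun _ x => x)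
  (ev := fun P => exists F0 : seq {classic G}, forall F, {subset F0 <= F} -> P F) vV).
- move=> F; apply: (bounded_graph_semiring_of_path (n := (size F).+1) vV) => //.
  + case: uG => dout din; split=> x y z /= [xy _] [xz _]; first exact: dout xy xz.
    exact: din xy xz.
  + move=> x y w; have [z] := walk_shorter (leqnSn _) w; exact: cut_no_walk.
  + by move=> x x' y y' /(cut_no_walk uG aG).
- by move=> P Q [F0 h] PQ; exists F0 => F /h /PQ.
- move=> P Q [F1 h1] [F2 h2]; exists (F1 ++ F2) => F sF; split.
    by apply: h1 => x xF; apply: sF; rewrite mem_cat xF.
  by apply: h2 => x xF; apply: sF; rewrite mem_cat xF orbT.
- by exists [::].
- by move=> [F h]; apply: (h F).
- move=> x y; split=> [xy|[F h]]; last by have [] := h F.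
  by exists [:: (x : {classic G})] => F sF; split=> //; apply: sF; rewrite mem_head.
- by move=> x y [F h]; apply: (h F).
Qed.

(** * The chain of subvarieties *)

Lemma Vp_variety n : variety (Vp n).
Proof. exact: generated_variety_variety. Qed.

Lemma Vpp_variety n : variety (Vpp n).
Proof. exact: generated_variety_variety. Qed.

Lemma Vp_path n : Vp n (graph_semiring (path_graph n)).
Proof. exact: generated_variety_gen. Qed.

Arguments Vp_path : clear implicits.

Lemma Vpp_double_path n : Vpp n (graph_semiring (double_path n)).
Proof. by rewrite -glued_semiringE; apply: generated_variety_gen. Qed.

Arguments Vpp_double_path : clear implicits.

Lemma Vp_min n V : variety V -> V (graph_semiring (path_graph n)) -> subclass (Vp n) V.
Proof. by move=> vV Vn; apply: generated_variety_min => // _ <-. Qed.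

Lemma Vpp_min n V : variety V -> V (graph_semiring (double_path n)) -> subclass (Vpp n) V.
Proof. by move=> vV Vn; apply: generated_variety_min => // _ <-; rewrite glued_semiringE. Qed.

Lemma Vp_sub_Vpp n : subclass (Vp n.+1) (Vpp n.+1).
Proof.
apply: Vp_min; first exact: Vpp_variety.
apply: (bounded_graph_semiring_of_double_path (Vpp_variety _) (Vpp_double_path _)).
  exact: path_unbranched.
exact: path_no_walk.
Qed.

Lemma double_path_unbranched n : unbranched (double_path n).
Proof. by apply: disjoint_sum_unbranched; apply: path_unbranched. Qed.

Lemma double_path_no_walk n : forall x y : double_path n, ~ walk n x y.
Proof. by apply: disjoint_sum_no_walk; apply: path_no_walk. Qed.

Lemma Vpp_sub_VpS n : subclass (Vpp n.+1) (Vp n.+2).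
Proof.
apply: Vpp_min; first exact: Vp_variety.
apply: (bounded_graph_semiring_of_path (Vp_variety _) (Vp_path _)).
- exact: double_path_unbranched.
- by move=> x y w; have [z] := walk_shorter (leqnSn _) w; apply: double_path_no_walk.
- by move=> x x' y y' /double_path_no_walk.
Qed.

Lemma Vp1_sub V H : variety V -> V (graph_semiring H) -> subclass (Vp 1) V.
Proof.
move=> vV VH; apply: Vp_min => //; apply: (edgeless_graph_semiring vV VH).
by move=> x y /walk1 /path_no_walk.
Qed.

Lemma Vp1_Vpp1 : Vp 1 = Vpp 1.
Proof.
apply: class_ext; first exact: Vp_sub_Vpp.
apply: Vpp_min; first exact: Vp_variety.
apply: (edgeless_graph_semiring (Vp_variety _) (Vp_path _)).
by move=> x y /walk1 /double_path_no_walk.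
Qed.

Lemma Vp_sub_Vac n : subclass (Vp n.+1) Vac.
Proof.
have S2 m : subclass (Vp m.+2) Vac.
  apply: (Vp_min Vac_variety); apply: graph_semiring_Vac; last exact: path_acyclic.
  exact: path_admissible.
by case: n => [|n] //; rewrite Vp1_Vpp1 => A /Vpp_sub_VpS /S2.
Qed.

(** The minimal [n] such that no graph of [W] has a walk of length [n] is the number
    of vertices of the longest path in [W]; for [n = 0] the graphs of [W] are empty
    and [W] is the least nontrivial variety. *)
Lemma subvarieties_of_Vac W : subvariety W Vac ->
  [\/ W = trivial_variety,
      exists2 n, (0 < n)%N & W = Vp n \/ W = Vpp n
    | W = Vac].
Proof.
move=> [vW _ WVac].
have WN A : W A -> NF3 A by move=> /WVac /Vac_NF3.
have Wac G : W (graph_semiring G) -> acyclic G by move=> /WVac /Vac_acyclic.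
case: (pselect (exists2 G, unbranched G & W (graph_semiring G))) => [[G0 _ WG0]|none]; last first.
  apply: Or31; apply: class_ext; last exact: variety_trivial.
  apply: (variety_graph_generated trivial_variety_variety vW WN) => G uG WG.
  by case: none; exists G.
pose bounded n := forall G, unbranched G -> W (graph_semiring G) -> forall x y : G, ~ walk n x y.
case: (pselect (exists n, `[<bounded n>])) => [ex|unb]; last first.
  apply: Or33; apply: class_ext => //; apply: (paths_generate_Vac vW) => n.
  apply: contrapT => nW; apply: unb; exists n; apply/asboolP => G uG WG x y xy; apply: nW.
  exact: (path_embeds vW WG uG (Wac G WG) xy).
apply: Or32; case: (ex_minnP ex) => -[|n] /asboolP bn minn.
  exists 1 => //; left; apply: class_ext; last exact: Vp1_sub WG0.
  apply: (variety_graph_generated (Vp_variety _) vW WN) => G uG WG.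
  by apply: (edgeless_graph_semiring (Vp_variety _) (Vp_path _)) => x; case: (bn G uG WG x x).
have Wn : W (graph_semiring (path_graph n.+1)).
  apply: contrapT => nW; have : n < n; last by rewrite ltnn.
  apply: minn; apply/asboolP => G uG WG x y xy; apply: nW.
  exact: (path_embeds vW WG uG (Wac G WG) xy).
exists n.+1 => //.
case: (pselect (exists G, [/\ unbranched G, W (graph_semiring G) &
   exists x x' y y' : G, [/\ walk n x x', walk n y y' & x <> y]])) => [two|one]; [right|left].
  case: two => G [uG WG [x [x' [y [y' [xx' yy' nxy]]]]]].
  apply: class_ext.
    apply: (variety_graph_generated (Vpp_variety _) vW WN) => H uH WH.
    apply: (bounded_graph_semiring_of_double_path (Vpp_variety _) (Vpp_double_path _)) => //.
    exact: bn.
  apply: (Vpp_min vW); apply: (double_path_embeds vW WG uG (Wac G WG) _ xx' yy' nxy).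
  exact: bn.
apply: class_ext; last exact: Vp_min.
apply: (variety_graph_generated (Vp_variety _) vW WN) => G uG WG.
apply: (bounded_graph_semiring_of_path (Vp_variety _) (Vp_path _)) => //; first exact: bn.
move=> x x' y y' xx' yy'; apply: contrapT => nxy; apply: one; exists G; split=> //.
by exists x, x', y, y'.
Qed.

(** The enumeration T, Vpp 1, Vp 2, Vpp 2, Vp 3, ...; [Vp 1] is left out as
    it equals [Vpp 1]. *)
Definition chain (k : nat) : class :=
  if k is k'.+1 then if odd k' then Vp k'./2.+2 else Vpp k'./2.+1
  else trivial_variety.

Lemma chain_odd m : chain m.*2.+1 = Vpp m.+1.
Proof. by rewrite /= odd_double doubleK. Qed.

Lemma chain_even m : chain m.*2.+2 = Vp m.+2.
Proof. by rewrite /= odd_double /= uphalf_double. Qed.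

(** Case analysis along the two shapes of nontrivial members of the chain. *)
Lemma chainP (P : nat -> Prop) :
  P 0 -> (forall m, P m.*2.+1) -> (forall m, P m.*2.+2) -> forall k, P k.
Proof.
move=> P0 P1 P2 [|k] //; rewrite -(odd_double_half k).
by case: (odd k); rewrite ?add1n ?add0n.
Qed.

Lemma chain_variety k : variety (chain k).
Proof.
elim/chainP: k => [|m|m]; first exact: trivial_variety_variety.
- by rewrite chain_odd; apply: Vpp_variety.
- by rewrite chain_even; apply: Vp_variety.
Qed.

Lemma chain_step k : subclass (chain k) (chain k.+1).
Proof.
elim/chainP: k => [|m|m]; first exact: variety_trivial (chain_variety 1).
- by rewrite chain_odd chain_even; apply: Vpp_sub_VpS.
- by rewrite chain_even -doubleS chain_odd; apply: Vp_sub_Vpp.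
Qed.

Lemma chain_strict k : ~ subclass (chain k.+1) (chain k).
Proof.
elim/chainP: k => [h|m|m].
- by have := h _ (Vpp_double_path 1) Zero Omega.
- rewrite chain_odd chain_even => h; apply: (@path_breaks_law m).
  apply: (Vpp_min (holds_variety _ _) _ (h _ (Vp_path _))).
  exact: no_walk_holds (@double_path_no_walk m.+1).
- rewrite chain_even -doubleS chain_odd => h; apply: (@double_path_no_merge m).
  by apply: (Vp_min (holds_variety _ _) _ (h _ (Vpp_double_path _))); apply: path_merge.
Qed.

Lemma chain_mono i j : i <= j -> subclass (chain i) (chain j).
Proof.
move=> /subnKC <-; elim: (j - i) => [|d IH]; first by rewrite addn0.
by rewrite addnS => A /IH; apply: chain_step.
Qed.

Lemma chain_le i j : subclass (chain i) (chain j) <-> i <= j.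
Proof.
split; last exact: chain_mono.
move=> ij; rewrite leqNgt; apply/negP => lt_ji; apply: (@chain_strict j) => A.
by move=> /(chain_mono lt_ji) /ij.
Qed.

Lemma chain_sub_Vac k : subclass (chain k) Vac.
Proof.
move=> A /(chain_mono (leqW (leq_addr k k))); rewrite addnn.
by move=> /chain_step; rewrite chain_even; apply: Vp_sub_Vac.
Qed.

Lemma Vac_not_sub_chain k : ~ subclass Vac (chain k).
Proof. by move=> h; apply: (@chain_strict k) => A /chain_sub_Vac /h. Qed.

Definition chain_top (a : nat + unit) : class := if a is inl k then chain k else Vac.

Lemma chain_top_le a b : subclass (chain_top a) (chain_top b) <-> omega_plus_one a b.
Proof.
case: a b => [i|[]] [j|[]] //=.
- exact: chain_le.
- by split=> // _; apply: chain_sub_Vac.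
- by split=> // /Vac_not_sub_chain.
- by split=> // _ A.
Qed.

Lemma chain_top_inj a b : chain_top a = chain_top b -> a = b.
Proof.
move=> E; have ab : omega_plus_one a b by apply/chain_top_le; rewrite E.
have ba : omega_plus_one b a by apply/chain_top_le; rewrite E.
move: a b ab ba {E} => [i|[]] [j|[]] //= ij ji.
by congr inl; apply/eqP; rewrite eqn_leq ij.
Qed.

Lemma chain_top_subvariety a : subvariety (chain_top a) Vac.
Proof.
case: a => [k|[]]; split=> //; try exact: Vac_variety; first exact: chain_variety.
exact: chain_sub_Vac.
Qed.

Lemma subvariety_chain_top W : subvariety W Vac -> exists a, W = chain_top a.
Proof.
case/subvarieties_of_Vac => [->|[[//|n] _ [->|->]]|->].
- by exists (inl 0).
- case: n => [|n]; first by exists (inl 1); rewrite Vp1_Vpp1.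
  by exists (inl n.*2.+2); rewrite [RHS]chain_even.
- by exists (inl n.*2.+1); rewrite [RHS]chain_odd.
- by exists (inr tt).
Qed.

Lemma chain_top_proper a b :
  omega_plus_one a b -> a <> b -> proper_subvariety (chain_top a) (chain_top b).
Proof.
move=> ab nab; have [va _ _] := chain_top_subvariety a.
have [vb _ _] := chain_top_subvariety b; split; last by move=> /chain_top_inj.
by split=> //; apply/chain_top_le.
Qed.

Theorem proposition4p7 :
  [/\ forall W : class, subvariety W Vac <->
        [\/ W = trivial_variety,
            exists2 n, (0 < n)%N & W = Vp n \/ W = Vpp n
          | W = Vac],
      proper_subvariety trivial_variety (Vp 1),
      Vp 1 = Vpp 1 /\
        (forall n, (1 < n)%N -> proper_subvariety (Vp n) (Vpp n)),
      forall n, (0 < n)%N ->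
        proper_subvariety (Vpp n) (Vp n.+1) /\ proper_subvariety (Vpp n) Vac &
      exists phi : subvarieties Vac -> nat + unit,
        [/\ bijective phi,
            forall W U : subvarieties Vac,
              subclass (proj1_sig W) (proj1_sig U) <->
              omega_plus_one (phi W) (phi U) &
            forall W : subvarieties Vac,
              proj1_sig W = Vac <-> phi W = inr tt]].
Proof.
split.
- move=> W; split; first exact: subvarieties_of_Vac.
  case=> [->|[[//|n] _ [->|->]]|->].
  + exact: (chain_top_subvariety (inl 0)).
  + by split; [apply: Vp_variety | apply: Vac_variety | apply: Vp_sub_Vac].
  + by rewrite -chain_odd; apply: (chain_top_subvariety (inl _)).
  + exact: (chain_top_subvariety (inr tt)).
- by rewrite Vp1_Vpp1; apply: (@chain_top_proper (inl 0) (inl 1)).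
- split; first exact: Vp1_Vpp1.
  move=> [|[|m]] // _; rewrite -chain_even -chain_odd.
  by apply: (@chain_top_proper (inl _) (inl _)) => [|[/eqP]] /=; lia.
- move=> [//|m] _; rewrite -chain_even -chain_odd; split.
    by apply: (@chain_top_proper (inl _) (inl _)) => [|[/eqP]] /=; lia.
  exact: (@chain_top_proper (inl _) (inr tt)).
- have [phi phiP] := choice (fun W : subvarieties Vac => subvariety_chain_top (svalP W)).
  pose psi a : subvarieties Vac :=
    exist (fun W => subvariety W Vac) (chain_top a) (chain_top_subvariety a).
  exists phi; split.
  + exists psi => [W|a]; last by apply: chain_top_inj; rewrite -phiP.
    by case: W (phiP W) => W sW /= E; apply: eq_exist.
  + by move=> W U; rewrite !phiP chain_top_le.
  + move=> W; rewrite phiP; split=> [E|->//].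
    exact: (@chain_top_inj _ (inr tt)).
Qed.
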